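(* Let $f(q)=1+\sum_{n=1}^{\infty}q^na_n$ (with $a_n\in\mathbb{H}$) be a function in $\mathcal{P}$. Then $$\Big|a_{2}-\frac{a_{1}^{2}}{2}\Big|\leq2-\frac{|a_{1}|^{2}}{2}.$$ Equality holds if and only if $$f(q)=(q\varphi_{a}(q)u+1)\ast(1-q\varphi_{a}(q)u)^{-\ast}$$ for some $a\in\overline{\mathbb{B}}$ and $u\in\partial\mathbb{B}$.
   Context: $\mathbb{H}$ denotes the quaternions, $\mathbb{B}=\{q\in\mathbb{H}:|q|<1\}$, $\mathbb{S}=\{q\in\mathbb{H}:q^2=-1\}$; for $I\in\mathbb{S}$, $\mathbb{C}_I=\mathbb{R}\oplus I\mathbb{R}$ and $\mathbb{B}_I=\mathbb{B}\cap\mathbb{C}_I$. A function $f:\mathbb{B}\to\mathbb{H}$ is (left) slice regular if for every $I\in\mathbb{S}$ the restriction $f_I=f|_{\mathbb{B}_I}$ has continuous partial derivatives and $\frac12\left(\frac{\partial}{\partial x}+I\frac{\partial}{\partial y}\right)f_I(x+yI)=0$ on $\mathbb{B}_I$; equivalently $f(q)=\sum_{n\ge0}q^na_n$ on $\mathbb{B}$ with $a_n\in\mathbb{H}$. For slice regular $f=\sum q^na_n$, $g=\sum q^nb_n$ on $\mathbb{B}$: the regular product is $f\ast g(q)=\sum_n q^n\sum_{k=0}^n a_kb_{n-k}$; the regular conjugate is $f^c(q)=\sum q^n\overline{a_n}$; the symmetrization is $f^s=f\ast f^c$; the regular reciprocal is $f^{-\ast}(q)=f^s(q)^{-1}f^c(q)$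 off the zero set of $f^s$. For $a\in\overline{\mathbb{B}}$, $\varphi_a(q)=(1-q\overline{a})^{-\ast}\ast(a-q)=a-(1-|a|^2)\sum_{n\ge1}q^n\overline{a}^{\,n-1}$. $\mathcal{P}$ (the Carathéodory class) is the class of slice regular functions $p$ on $\mathbb{B}$ with $p(0)=1$ and $\mathrm{Re}\,p(q)>0$ on $\mathbb{B}$. *)

(* Defs.v *)
From HB Require Import structures.
From mathcomp Require Import all_boot all_order all_algebra.
From mathcomp Require Import all_classical all_reals all_analysis.
From mathcomp Require Import ring lra.
Import Order.TTheory GRing.Theory Num.Theory.
Import numFieldNormedType.Exports.

Set Implicit Arguments.
Unset Strict Implicit.
Unset Printing Implicit Defensive.

Local Open Scope classical_set_scope.
Local Open Scope ring_scope.

(* [Quat x0 x1 x2 x3] is x0 + x1 i + x2 j + x3 k. *)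
Record quat (R : Type) := Quat { qre : R; qimi : R; qimj : R; qimk : R }.

Lemma quatP (R : Type) (p q : quat R) : qre p = qre q -> qimi p = qimi q ->
  qimj p = qimj q -> qimk p = qimk q -> p = q.
Proof. by case: p => ? ? ? ?; case: q => ? ? ? ? /= -> -> -> ->. Qed.

Section QuatAlgebra.
Variable R : realType.
Implicit Types p q : quat R.

Definition quat_to_prod q := (qre q, qimi q, qimj q, qimk q).
Definition quat_of_prod (t : R * R * R * R) :=
  let: (x0, x1, x2, x3) := t in Quat x0 x1 x2 x3.

Lemma quat_to_prodK : cancel quat_to_prod quat_of_prod.
Proof. by case. Qed.

HB.instance Definition _ := Choice.copy (quat R) (can_type quat_to_prodK).

Definition quat0 : quat R := Quat 0 0 0 0.
Definition quat1 : quat R := Quat 1 0 0 0.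

Definition quat_opp q := Quat (- qre q) (- qimi q) (- qimj q) (- qimk q).

Definition quat_add p q := Quat (qre p + qre q) (qimi p + qimi q)
  (qimj p + qimj q) (qimk p + qimk q).

Definition quat_scale (l : R) q :=
  Quat (l * qre q) (l * qimi q) (l * qimj q) (l * qimk q).

Definition quat_mul p q :=
  let: Quat a b c d := p in let: Quat a' b' c' d' := q in
  Quat (a * a' - b * b' - c * c' - d * d')
       (a * b' + b * a' + c * d' - d * c')
       (a * c' - b * d' + c * a' + d * b')
       (a * d' + b * c' - c * b' + d * a').

Definition quat_conj q := Quat (qre q) (- qimi q) (- qimj q) (- qimk q).

Definition quat_sqnorm q :=
  qre q ^+ 2 + qimi q ^+ 2 + qimj q ^+ 2 + qimk q ^+ 2.

Definition quat_norm q : R := Num.sqrt (quat_sqnorm q).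

Definition quat_inv q := quat_scale (quat_sqnorm q)^-1 (quat_conj q).

Fact quat_addA : associative quat_add.
Proof. by move=> p q r; apply: quatP => /=; ring. Qed.
Fact quat_addC : commutative quat_add.
Proof. by move=> p q; apply: quatP => /=; ring. Qed.
Fact quat_add0 : left_id quat0 quat_add.
Proof. by move=> p; apply: quatP => /=; ring. Qed.
Fact quat_addN : left_inverse quat0 quat_opp quat_add.
Proof. by move=> p; apply: quatP => /=; ring. Qed.

HB.instance Definition _ :=
  GRing.isZmodule.Build (quat R) quat_addA quat_addC quat_add0 quat_addN.

Fact quat_mulA : associative quat_mul.
Proof. by case=> ? ? ? ? [? ? ? ?] [? ? ? ?]; apply: quatP => /=; ring. Qed.
Fact quat_mul1l : left_id quat1 quat_mul.
Proof. by case=> ? ? ? ?; apply: quatP => /=; ring. Qed.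
Fact quat_mul1r : right_id quat1 quat_mul.
Proof. by case=> ? ? ? ?; apply: quatP => /=; ring. Qed.
Fact quat_mulDl : left_distributive quat_mul quat_add.
Proof. by case=> ? ? ? ? [? ? ? ?] [? ? ? ?]; apply: quatP => /=; ring. Qed.
Fact quat_mulDr : right_distributive quat_mul quat_add.
Proof. by case=> ? ? ? ? [? ? ? ?] [? ? ? ?]; apply: quatP => /=; ring. Qed.
Fact quat1_neq0 : quat1 != quat0.
Proof. by apply/eqP => -[] /eqP; rewrite oner_eq0. Qed.

HB.instance Definition _ := GRing.Zmodule_isNzRing.Build (quat R)
  quat_mulA quat_mul1l quat_mul1r quat_mulDl quat_mulDr quat1_neq0.

Fact quat_scaleA a b q : quat_scale a (quat_scale b q) = quat_scale (a * b) q.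
Proof. by apply: quatP => /=; ring. Qed.
Fact quat_scale1 : left_id 1 quat_scale.
Proof. by move=> q; apply: quatP => /=; ring. Qed.
Fact quat_scaleDr : right_distributive quat_scale +%R.
Proof. by move=> a p q; apply: quatP => /=; ring. Qed.
Fact quat_scaleDl q : {morph quat_scale^~ q : a b / a + b}.
Proof. by move=> a b; apply: quatP => /=; ring. Qed.

HB.instance Definition _ := GRing.Zmodule_isLmodule.Build R (quat R)
  quat_scaleA quat_scale1 quat_scaleDr quat_scaleDl.

Fact quat_scaleAl (l : R) (p q : quat R) : l *: (p * q) = (l *: p) * q.
Proof. by case: p q => ? ? ? ? [? ? ? ?]; apply: quatP => /=; ring. Qed.
HB.instance Definition _ :=
  GRing.Lmodule_isLalgebra.Build R (quat R) quat_scaleAl.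

Fact quat_scaleAr (l : R) (p q : quat R) : l *: (p * q) = p * (l *: q).
Proof. by case: p q => ? ? ? ? [? ? ? ?]; apply: quatP => /=; ring. Qed.
HB.instance Definition _ :=
  GRing.Lalgebra_isAlgebra.Build R (quat R) quat_scaleAr.

Fact quat_sqnorm_ge0 q : 0 <= quat_sqnorm q.
Proof. by rewrite /quat_sqnorm !addr_ge0// sqr_ge0. Qed.

Fact quat_sqnorm_eq0 q : quat_sqnorm q = 0 -> q = 0.
Proof.
case: q => a b c d; rewrite /quat_sqnorm /= => h.
have [a0 b0 c0 d0] : [/\ 0 <= a ^+ 2, 0 <= b ^+ 2, 0 <= c ^+ 2 & 0 <= d ^+ 2].
  by split; exact: sqr_ge0.
by apply: quatP => /=; apply/eqP; rewrite -sqrf_eq0 eq_le; apply/andP; split;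
  lra.
Qed.

Fact quat_mulVl : {in [pred q | q != 0], left_inverse 1 quat_inv *%R}.
Proof.
move=> q; rewrite inE => q0.
have /eqP : quat_sqnorm q != 0 by apply: contra_neq q0; exact: quat_sqnorm_eq0.
case: q {q0} => a b c d; rewrite /quat_inv /quat_sqnorm /= => /eqP h.
by apply: quatP => /=; field.
Qed.
Fact quat_mulVr : {in [pred q | q != 0], right_inverse 1 quat_inv *%R}.
Proof.
move=> q; rewrite inE => q0.
have /eqP : quat_sqnorm q != 0 by apply: contra_neq q0; exact: quat_sqnorm_eq0.
case: q {q0} => a b c d; rewrite /quat_inv /quat_sqnorm /= => /eqP h.
by apply: quatP => /=; field.
Qed.
Fact quat_unitP p q : q * p = 1 /\ p * q = 1 -> [pred q | q != 0] p.
Proof.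
move=> [qp _] /=; apply/eqP => p0; move: qp; rewrite p0 mulr0 => /eqP.
by rewrite eq_sym oner_eq0.
Qed.
Fact quat_inv_out : {in [predC [pred q | q != 0]], quat_inv =1 id}.
Proof.
move=> q; rewrite !inE negbK => /eqP ->; rewrite /quat_inv.
by apply: quatP => /=; rewrite ?oppr0 mulr0.
Qed.

HB.instance Definition _ :=
  GRing.NzRing_hasMulInverse.Build (quat R)
    quat_mulVl quat_mulVr quat_unitP quat_inv_out.

Fact quat_normD p q : quat_norm (p + q) <= quat_norm p + quat_norm q.
Proof.
rewrite -(@ler_pXn2r _ 2)// ?nnegrE ?addr_ge0 ?sqrtr_ge0//.
rewrite sqrrD !sqr_sqrtr ?quat_sqnorm_ge0// -sqrtrM ?quat_sqnorm_ge0//.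
set s := Num.sqrt _.
suff : qre p * qre q + qimi p * qimi q + qimj p * qimj q + qimk p * qimk q <= s.
  by rewrite /quat_sqnorm /= => h; rewrite -subr_ge0 mulr2n; lra.
apply: (le_trans (ler_norm _)); rewrite -sqrtr_sqr ler_wsqrtr//.
case: p q {s} => a b c d [a' b' c' d']; rewrite /quat_sqnorm /= -subr_ge0.
rewrite [leRHS](_ : _ = (a * b' - b * a') ^+ 2 + (a * c' - c * a') ^+ 2 +
  (a * d' - d * a') ^+ 2 + (b * c' - c * b') ^+ 2 + (b * d' - d * b') ^+ 2 +
  (c * d' - d * c') ^+ 2); last by ring.
by rewrite !addr_ge0// sqr_ge0.
Qed.

Fact quat_normZ (l : R) q : quat_norm (l *: q) = `|l| * quat_norm q.
Proof.
rewrite /quat_norm [quat_sqnorm _](_ : _ = l ^+ 2 * quat_sqnorm q).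
  by rewrite sqrtrM ?sqr_ge0// sqrtr_sqr.
by rewrite /quat_sqnorm /=; ring.
Qed.

Fact quat_norm_eq0 q : quat_norm q = 0 -> q = 0.
Proof.
move=> /eqP; rewrite sqrtr_eq0 => h; apply: quat_sqnorm_eq0.
by apply/eqP; rewrite eq_le h quat_sqnorm_ge0.
Qed.

HB.instance Definition _ :=
  Lmodule_isNormed.Build R (quat R) quat_normD quat_normZ quat_norm_eq0.

End QuatAlgebra.

(* Functions on the ball are represented by total functions [quat R -> quat R]
   whose values outside the ball are irrelevant. *)

Section SliceRegular.
Variable R : realType.
Local Notation H := (quat R).
Implicit Types f g : H -> H.

Definition qball : set H := [set q | `|q| < 1].

Definition imag_unit : set H := [set I | I ^+ 2 = -1].

Definition slice (I : H) (x y : R) : H := x%:A + y *: I.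

Definition slice_dx f (I : H) (x y : R) : H :=
  derive1 (fun t : R => f (slice I t y)) x.
Definition slice_dy f (I : H) (x y : R) : H :=
  derive1 (fun t : R => f (slice I x t)) y.

Definition slice_regular f : Prop :=
  forall I : H, imag_unit I -> forall x y : R, qball (slice I x y) ->
  [/\ derivable (fun t : R => f (slice I t y)) x 1,
      derivable (fun t : R => f (slice I x t)) y 1,
      {for (x, y), continuous (fun z : R * R => slice_dx f I z.1 z.2)},
      {for (x, y), continuous (fun z : R * R => slice_dy f I z.1 z.2)} &
      2^-1 *: (slice_dx f I x y + I * slice_dy f I x y) = 0].

Definition caratheodory f : Prop :=
  [/\ slice_regular f, f 0 = 1 & forall q, qball q -> 0 < qre (f q)].

Definition qseries (a : nat -> H) (q : H) : H^nat :=
  series (fun n => q ^+ n * a n).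

Definition qexpansion f (a : nat -> H) : Prop :=
  forall q, qball q -> qseries a q @ \oo --> f q.

(* The coefficients of the expansion of [f], which are unique when they exist;
   the zero sequence if [f] has no expansion on the ball. *)
Definition qcoef f : nat -> H :=
  xget (fun=> 0) [set a : nat -> H | qexpansion f a].

Definition qsum (a : nat -> H) (q : H) : H := lim (qseries a q @ \oo).

Definition rprod f g : H -> H :=
  qsum (fun n => \sum_(k < n.+1) qcoef f k * qcoef g (n - k)).

Definition rconj f : H -> H := qsum (fun n => quat_conj (qcoef f n)).

Definition symmetrization f : H -> H := rprod f (rconj f).

(* Meaningful off the zero set of [symmetrization f]; note [0^-1 = 0]. *)
Definition rrecip f : H -> H := fun q => (symmetrization f q)^-1 * rconj f q.

Definition phi (a : H) : H -> H :=
  rprod (rrecip (fun q => 1 - q * quat_conj a)) (fun q => a - q).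

End SliceRegular.

(* Main.v *)
(* If Re f > 0 on the ball, then at a point x + I y the value of f is b + I g, and
   letting I vary over the imaginary units makes b + i g, as an element of the
   complexified quaternions, a matrix with nonnegative hermitian part. Averaging
   over roots of unity, as for classical Caratheodory functions, shows that
   multiplication by f is accretive on finite sequences of quaternions:
   sum_j Re (c_j^* (a * c)_j) >= 0, where * is the convolution. With
   D = a_2 - a_1^2 / 2 = - |D| u, |u| = 1, the vector
   c = (1, - (a_1 + a_1^* u) / 2, u) gives the value 2 - |a_1|^2 / 2 - |D|, hence
   the inequality. If equality holds, c is a null vector, so (a * c)_j = 0 for
   j >= 3: f is a quotient of quadratic polynomials, which is identified with the
   Cayley transform of q phi_b(q) u, where b = a_1 u^* / 2.
   Coefficients are determined by the values at small real points, where the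
   regular product is the pointwise one. *)

Require Import Defs.
From mathcomp Require Import all_boot all_order all_algebra.
From mathcomp Require Import all_classical all_reals all_analysis.
From mathcomp Require Import ring lra zify.
Import Order.TTheory GRing.Theory Num.Theory.
Import numFieldNormedType.Exports.
Local Open Scope classical_set_scope.
Local Open Scope ring_scope.

Set Implicit Arguments.
Unset Strict Implicit.
Unset Printing Implicit Defensive.

(** * Quaternion algebra and limits *)

Section QuaternionNorm.
Context {R : realType}.
Local Notation H := (quat R).
Implicit Types p q x y : H.

Lemma qreD p q : qre (p + q) = qre p + qre q. Proof. by []. Qed.
Lemma qreN p : qre (- p) = - qre p. Proof. by []. Qed.
Lemma qreB p q : qre (p - q) = qre p - qre q. Proof. by []. Qed.
Lemma qreZ (t : R) p : qre (t *: p) = t * qre p. Proof. by []. Qed.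

Lemma qre_sum (I : Type) (r : seq I) (P : pred I) (F : I -> H) :
  qre (\sum_(i <- r | P i) F i) = \sum_(i <- r | P i) qre (F i).
Proof. by elim/big_rec2: _ => // i s t _ <-. Qed.

Lemma qreM_sym p q : qre (p * q) = qre (q * p).
Proof. by case: p q => ? ? ? ? [? ? ? ?] /=; ring. Qed.

Lemma qconjD p q : quat_conj (p + q) = quat_conj p + quat_conj q.
Proof. by apply: quatP => //=; ring. Qed.

Lemma qconjN p : quat_conj (- p) = - quat_conj p.
Proof. by apply: quatP => //=; ring. Qed.

Lemma qconjZ (t : R) p : quat_conj (t *: p) = t *: quat_conj p.
Proof. by apply: quatP => //=; ring. Qed.

Lemma qconj0 : quat_conj (0 : H) = 0.
Proof. by apply: quatP => //=; ring. Qed.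

Lemma qconj1 : quat_conj (1 : H) = 1.
Proof. by apply: quatP => //=; ring. Qed.

Lemma qconjM p q : quat_conj (p * q) = quat_conj q * quat_conj p.
Proof. by case: p q => ? ? ? ? [? ? ? ?]; apply: quatP => /=; ring. Qed.

Lemma qconjK p : quat_conj (quat_conj p) = p.
Proof. by apply: quatP => //=; ring. Qed.

Lemma qconj_sum (I : Type) (r : seq I) (P : pred I) (F : I -> H) :
  quat_conj (\sum_(i <- r | P i) F i) = \sum_(i <- r | P i) quat_conj (F i).
Proof. by apply: (big_morph _ qconjD); exact: qconj0. Qed.

Lemma qnormE p : `|p| = quat_norm p. Proof. by []. Qed.

Lemma qnorm_sqr p : `|p| ^+ 2 = quat_sqnorm p.
Proof. by rewrite qnormE sqr_sqrtr// quat_sqnorm_ge0. Qed.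

Lemma qnorm1 : `|1 : H| = 1.
Proof.
by rewrite qnormE /quat_norm /quat_sqnorm /= expr1n expr0n /= !addr0 sqrtr1.
Qed.

Lemma qnormM p q : `|p * q| = `|p| * `|q|.
Proof.
rewrite !qnormE /quat_norm -sqrtrM ?quat_sqnorm_ge0//; congr Num.sqrt.
by case: p q => ? ? ? ? [? ? ? ?]; rewrite /quat_sqnorm /=; ring.
Qed.

Lemma qnormX p n : `|p ^+ n| = `|p| ^+ n.
Proof. by elim: n => [|n IH]; rewrite ?expr0 ?qnorm1// !exprS qnormM IH. Qed.

Lemma qnorm_conj p : `|quat_conj p| = `|p|.
Proof.
by rewrite !qnormE /quat_norm /quat_sqnorm /=; congr Num.sqrt; ring.
Qed.

Lemma qnormA (t : R) : `|t%:A : H| = `|t|.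
Proof. by rewrite normrZ qnorm1 mulr1. Qed.

Lemma qre_le_norm p : `|qre p| <= `|p|.
Proof.
rewrite qnormE -sqrtr_sqr ler_wsqrtr// /quat_sqnorm -!addrA lerDl.
by rewrite !addr_ge0// sqr_ge0.
Qed.

Lemma qmul_conjr p : p * quat_conj p = (`|p| ^+ 2)%:A.
Proof.
by rewrite qnorm_sqr /quat_sqnorm; case: p => ? ? ? ?; apply: quatP => /=; ring.
Qed.

Lemma qmul_conjl p : quat_conj p * p = (`|p| ^+ 2)%:A.
Proof. by rewrite -{2}(qconjK p) qmul_conjr qnorm_conj. Qed.

Lemma qA_comm (t : R) p : p * t%:A = t%:A * p.
Proof. by rewrite -scalerAl -scalerAr mulr1 mul1r. Qed.

Lemma qA_exp (t : R) n : (t%:A : H) ^+ n = (t ^+ n)%:A.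
Proof. by rewrite exprZn expr1n. Qed.

Lemma qconj_real p : quat_conj p = p -> p = (qre p)%:A.
Proof.
by case: p => a b c d [] hb hc hd; apply: quatP => /=; lra.
Qed.

Lemma qunitE p : (p \is a GRing.unit) = (p != 0). Proof. by []. Qed.

Lemma qinvE p : p^-1 = (`|p| ^- 2) *: quat_conj p.
Proof. by rewrite qnorm_sqr. Qed.

End QuaternionNorm.

Section QuaternionLimits.
Context {R : realType}.
Local Notation H := (quat R).

Lemma quat_coordE (p : H) : p = qre p *: (1 : H) + qimi p *: Quat 0 1 0 0 +
  qimj p *: Quat 0 0 1 0 + qimk p *: Quat 0 0 0 1.
Proof. by apply: quatP => /=; ring. Qed.

Lemma quat_coord_le (p : H) : [/\ `|qre p| <= `|p|, `|qimi p| <= `|p|,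
  `|qimj p| <= `|p| & `|qimk p| <= `|p|].
Proof.
rewrite !qnormE /quat_norm /quat_sqnorm -!sqrtr_sqr.
have := (sqr_ge0 (qre p), sqr_ge0 (qimi p), sqr_ge0 (qimj p), sqr_ge0 (qimk p)).
by move=> [[[h1 h2] h3] h4]; split; rewrite ler_wsqrtr//; lra.
Qed.

Section Coordinates.
Context {T : Type} {F : set_system T} {FF : Filter F}.

Lemma qcvg_coord (f : T -> H) (l : H) :
  f @ F --> l <-> [/\ qre (f x) @[x --> F] --> qre l,
    qimi (f x) @[x --> F] --> qimi l, qimj (f x) @[x --> F] --> qimj l &
    qimk (f x) @[x --> F] --> qimk l].
Proof.
split=> [fl|[f0 f1 f2 f3]].
  by split; apply/cvgrPdist_le => e e0; move/cvgrPdist_le: fl => /(_ e e0);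
    apply: filterS => x; apply: le_trans; have [] := quat_coord_le (l - f x).
rewrite (quat_coordE l) [X in X @ _](_ : _ = fun x => qre (f x) *: (1 : H) +
  qimi (f x) *: Quat 0 1 0 0 + qimj (f x) *: Quat 0 0 1 0 +
  qimk (f x) *: Quat 0 0 0 1).
  by apply: cvgD; [apply: cvgD; [apply: cvgD|]|]; apply: cvgZr_tmp.
by apply/funext => x; exact: quat_coordE.
Qed.

Lemma qcvgM (f g : T -> H) (l m : H) : f @ F --> l -> g @ F --> m ->
  f x * g x @[x --> F] --> l * m.
Proof.
move=> /qcvg_coord[f0 f1 f2 f3] /qcvg_coord[g0 g1 g2 g3].
have mulE p q : p * q = Quat
    (qre p * qre q - qimi p * qimi q - qimj p * qimj q - qimk p * qimk q)
    (qre p * qimi q + qimi p * qre q + qimj p * qimk q - qimk p * qimj q)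
    (qre p * qimj q - qimi p * qimk q + qimj p * qre q + qimk p * qimi q)
    (qre p * qimk q + qimi p * qimj q - qimj p * qimi q + qimk p * qre q).
  by case: p q => ? ? ? ? [].
under [X in X @ _ --> _]eq_fun do rewrite mulE.
rewrite mulE; apply/qcvg_coord; split.
- by apply: cvgB; [apply: cvgB; [apply: cvgB|]|]; exact: cvgM.
- by apply: cvgB; [apply: cvgD; [apply: cvgD|]|]; exact: cvgM.
- by apply: cvgD; [apply: cvgD; [apply: cvgB|]|]; exact: cvgM.
- by apply: cvgD; [apply: cvgB; [apply: cvgD|]|]; exact: cvgM.
Qed.

Lemma qcvg_conj (f : T -> H) (l : H) : f @ F --> l ->
  quat_conj (f x) @[x --> F] --> quat_conj l.
Proof.
by move=> /qcvg_coord[f0 f1 f2 f3]; apply/qcvg_coord; split => //=; apply: cvgN.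
Qed.

End Coordinates.

(** Each coordinate is at most the norm, so the four real coordinate series converge absolutely. *)
Lemma qseries_abs_cvg (u : nat -> H) :
  cvgn (series (fun n => `|u n|)) -> cvgn (series u).
Proof.
move=> cu.
have comp (c : H -> R) : (forall p, `|c p| <= `|p|) ->
    cvgn (series (fun n => c (u n))).
  move=> hc; apply: normed_cvg.
  by apply: series_le_cvg cu => n //=; exact: hc.
have c0 : cvgn (series (fun n => qre (u n))).
  by apply: comp => p; have [] := quat_coord_le p.
have c1 : cvgn (series (fun n => qimi (u n))).
  by apply: comp => p; have [] := quat_coord_le p.
have c2 : cvgn (series (fun n => qimj (u n))).
  by apply: comp => p; have [] := quat_coord_le p.
have c3 : cvgn (series (fun n => qimk (u n))).
  by apply: comp => p; have [] := quat_coord_le p.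
have E (c : H -> R) (c0' : c 0 = 0) (cD : {morph c : p q / p + q}) :
    (fun n => c (series u n)) = series (fun n => c (u n)).
  by apply/funext => n; rewrite /series /= (big_morph c cD c0').
apply/cvg_ex; exists (Quat (limn (series (fun n => qre (u n))))
  (limn (series (fun n => qimi (u n)))) (limn (series (fun n => qimj (u n))))
  (limn (series (fun n => qimk (u n))))).
by apply/qcvg_coord; rewrite !E //=; split.
Qed.

End QuaternionLimits.

(** * Power series on the ball *)

(** Both sides grow by the antidiagonal i + j = N when N becomes N + 1. *)
Lemma sum_triangle (V : nmodType) (F : nat -> nat -> V) (N : nat) :
  \sum_(0 <= n < N) \sum_(k < n.+1) F k (n - k)%N =
  \sum_(0 <= i < N) \sum_(0 <= j < N - i) F i j.
Proof.
elim: N => [|N IH]; first by rewrite !big_nil.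
rewrite big_nat_recr//= IH [RHS]big_nat_recr//= subSnn big_nat1.
rewrite [X in _ = X + _](_ : _ = \sum_(0 <= i < N) \sum_(0 <= j < N - i) F i j +
    \sum_(0 <= i < N) F i (N - i)%N).
  by rewrite -addrA big_ord_recr/= subnn [in RHS]addrC !big_mkord [in RHS]addrC.
rewrite -big_split/=; apply: eq_big_nat => i /andP[_ iN].
by rewrite subSn 1?ltnW// big_nat_recr.
Qed.

Section CauchyProduct.
Context {R : realType}.
Local Notation H := (quat R).

(** The triangle i + j < N lies in the square i, j < N, which lies in the triangle i + j < 2N. For
    nonnegative terms this squeezes the product of the partial sums between the partial sums of the
    convolution at N and at 2N. *)
Lemma cauchy_product_ge0 (X Y : nat -> R) :
  (forall n, 0 <= X n) -> (forall n, 0 <= Y n) ->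
  cvgn (series X) -> cvgn (series Y) ->
  cvgn (series (fun n => \sum_(k < n.+1) X k * Y (n - k)%N)) /\
  series X N * series Y N - series (fun n => \sum_(k < n.+1) X k * Y (n - k)%N) N
    @[N --> \oo] --> 0.
Proof.
move=> X0 Y0 cX cY; set C := fun n => \sum_(k < n.+1) X k * Y (n - k)%N.
have C0 n : 0 <= C n by apply: sumr_ge0 => k _; exact: mulr_ge0.
have nd (Z : nat -> R) : (forall n, 0 <= Z n) -> nondecreasing_seq (series Z).
  by move=> Z0; apply: nondecreasing_series.
have ge0 (Z : nat -> R) n : (forall n, 0 <= Z n) -> 0 <= series Z n.
  by move=> Z0; apply: sumr_ge0.
have CE N : series C N = \sum_(0 <= i < N) \sum_(0 <= j < N - i) X i * Y j.
  by rewrite /series /= -(@sum_triangle R (fun i j => X i * Y j)).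
have PE N : series X N * series Y N =
    \sum_(0 <= i < N) \sum_(0 <= j < N) X i * Y j.
  by rewrite /series /= big_distrl /=; apply: eq_bigr => i _; rewrite big_distrr.
have sub_le (i m n : nat) : (m <= n)%N ->
    \sum_(0 <= j < m) X i * Y j <= \sum_(0 <= j < n) X i * Y j.
  move=> mn; rewrite [leRHS](big_cat_nat (leq0n m) mn)/= lerDl.
  by apply: sumr_ge0 => j _; exact: mulr_ge0.
have CP N : series C N <= series X N * series Y N.
  rewrite CE PE; apply: ler_sum => i _; apply: sub_le; exact: leq_subr.
have PC N : series X N * series Y N <= series C (N + N)%N.
  rewrite CE PE [leRHS](big_cat_nat (leq0n N) (leq_addr N N))/=.
  rewrite -[leLHS]addr0 lerD//; last first.
    by apply: sumr_ge0 => i _; apply: sumr_ge0 => j _; exact: mulr_ge0.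
  rewrite big_nat_cond [leRHS]big_nat_cond.
  apply: ler_sum => i /andP[/andP[_ iN] _].
  by apply: sub_le; rewrite -addnBA ?leq_addr// ltnW.
have cP : series X N * series Y N @[N --> \oo] -->
  limn (series X) * limn (series Y) by apply: cvgM.
have cC : cvgn (series C).
  apply: nondecreasing_is_cvgn; first exact: nd.
  exists (limn (series X) * limn (series Y)) => _ [n _ <-].
  apply: (le_trans (CP n)); apply: ler_pM; rewrite ?ge0//.
  - by apply: nondecreasing_cvgn_le => //; exact: nd.
  - by apply: nondecreasing_cvgn_le => //; exact: nd.
split => //.
have -> : 0 = limn (series X) * limn (series Y) - limn (series C).
  apply/esym/eqP; rewrite subr_eq0 eq_le; apply/andP; split.
    rewrite -(cvg_lim _ cP)//; apply: limr_le; first exact: cvgP cP.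
    apply: nearW => n; apply: (le_trans (PC n)).
    by apply: nondecreasing_cvgn_le => //; exact: nd.
  by rewrite -(cvg_lim _ cP)//; apply: ler_lim; [|exact: cvgP cP|exact: nearW].
by apply: cvgB.
Qed.

(** The square minus the triangle consists of the terms with i + j >= N. As the norm is
    multiplicative, their sum is dominated by the same difference for the real sequences |x_n| and
    |y_n|, which tends to 0. *)
Lemma qcauchy_product (x y : nat -> H) :
  cvgn (series (fun n => `|x n|)) -> cvgn (series (fun n => `|y n|)) ->
  series (fun n => \sum_(k < n.+1) x k * y (n - k)%N) @ \oo -->
  limn (series x) * limn (series y).
Proof.
move=> cx cy.
have [_ c0] := @cauchy_product_ge0 (fun n => `|x n|) (fun n => `|y n|)
  (fun=> normr_ge0 _) (fun=> normr_ge0 _) cx cy.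
have cP : series x N * series y N @[N --> \oo] -->
    limn (series x) * limn (series y).
  by apply: qcvgM; exact: qseries_abs_cvg.
set Z := series (fun n => \sum_(k < n.+1) x k * y (n - k)%N).
suff Z0 : Z N - series x N * series y N @[N --> \oo] --> 0.
  exact: cvg_sub0 Z0 cP.
apply/norm_cvg0P.
apply: (squeeze_cvgr _ (cvg_cst 0) c0); apply: nearW => N.
rewrite normr_ge0/= distrC.
(* Stated over any ring, to serve once for the quaternions and once for their norms. *)
have E (K : pzRingType) (X Y : nat -> K) : series X N * series Y N -
    series (fun n => \sum_(k < n.+1) X k * Y (n - k)%N) N =
    \sum_(0 <= i < N) \sum_(N - i <= j < N) X i * Y j.
  rewrite /series/= (@sum_triangle K (fun i j => X i * Y j)) big_distrl/= -sumrB.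
  apply: eq_big_nat => i _; rewrite big_distrr/=.
  rewrite [X in X - _](big_cat_nat (leq0n (N - i)) (leq_subr i N))/=.
  by rewrite addrAC subrr add0r.
rewrite E; apply: (le_trans (ler_norm_sum _ _ _)).
apply: (@le_trans _ _ (\sum_(0 <= i < N) \sum_(N - i <= j < N) `|x i| * `|y j|)).
  apply: ler_sum => i _; apply: (le_trans (ler_norm_sum _ _ _)).
  by apply: ler_sum => j _; rewrite qnormM.
by rewrite -E.
Qed.

End CauchyProduct.

(** The coefficients of the regular product. In the accretivity argument it is also the action of
    the lower triangular Toeplitz matrix of [a] on the vector [b]. *)
Definition qconv {R : realType} (a b : nat -> quat R) (n : nat) : quat R :=
  \sum_(k < n.+1) a k * b (n - k)%N.

(** As |q^n a_n| = |a_n| |q|^n, this is absolute convergence of the series at every point of the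
    ball. *)
Definition ball_summable {R : realType} (a : nat -> quat R) : Prop :=
  forall r : R, 0 <= r -> r < 1 -> cvgn (series (fun n => `|a n| * r ^+ n)).

Section Convolution.
Context {R : realType}.
Implicit Types a b : nat -> quat R.

Lemma qconv0 a b : qconv a b 0 = a 0%N * b 0%N.
Proof. by rewrite /qconv big_ord_recl big_ord0 addr0. Qed.

Lemma qconv1 a b : qconv a b 1 = a 0%N * b 1%N + a 1%N * b 0%N.
Proof. by rewrite /qconv !big_ord_recl big_ord0 addr0. Qed.

Lemma qconv2 a b :
  qconv a b 2 = a 0%N * b 2%N + a 1%N * b 1%N + a 2%N * b 0%N.
Proof. by rewrite /qconv !big_ord_recl big_ord0 addr0 addrA. Qed.

End Convolution.

Section BallSummable.
Context {R : realType}.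
Local Notation H := (quat R).
Implicit Types (a b : nat -> H) (f g : H -> H).

Lemma qterm_norm a (q : H) n : `|q ^+ n * a n| = `|a n| * `|q| ^+ n.
Proof. by rewrite qnormM qnormX mulrC. Qed.

Lemma ball_summable_abs a q : ball_summable a -> qball q ->
  cvgn (series (fun n => `|q ^+ n * a n|)).
Proof.
move=> ha qb; have /= := ha `|q| (normr_ge0 _) qb.
by under [X in series X]eq_fun do rewrite -qterm_norm.
Qed.

Lemma qsum_cvg a q : ball_summable a -> qball q ->
  qseries a q @ \oo --> qsum a q.
Proof. by move=> ha qb; apply/qseries_abs_cvg/ball_summable_abs. Qed.

Lemma qexpansion_qsum a : ball_summable a -> qexpansion (qsum a) a.
Proof. by move=> ha q qb; exact: qsum_cvg. Qed.

Lemma qsum_qexpansion f a q : qexpansion f a -> qball q -> qsum a q = f q.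
Proof. by move=> fa qb; apply: cvg_lim => //; exact: fa. Qed.

Lemma qball_real (t : R) : qball (t%:A : H) <-> `|t| < 1.
Proof. by rewrite /qball/= qnormA. Qed.

(** Abel's lemma: convergence at a real point s between r and 1 bounds |a_n| s^n, and the series is
    then dominated by a geometric one of ratio r / s. *)
Lemma qexpansion_summable f a : qexpansion f a -> ball_summable a.
Proof.
move=> fa r r0 r1; set s := (1 + r) / 2.
have s01 : 0 < s < 1 by rewrite /s; lra.
have [s0 s1] := andP s01.
have sb : qball (s%:A : H) by apply/qball_real; rewrite gtr0_norm.
have := fa _ sb => /cvgP/cvg_series_cvg_0 /cvg_norm /cvgP /cvg_seq_bounded.
move=> -[M [_ hM]]; pose C := M + 1.
have hC : forall n, `| (`|s%:A ^+ n * a n|) | <= C.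
  by move=> n; apply: (hM C) => //; rewrite /C ltrDl.
have C0 n : `|a n| * s ^+ n <= C.
  by have := hC n; rewrite normr_id qterm_norm qnormA gtr0_norm.
apply: (@series_le_cvg _ _ (geometric C (r / s))).
- by move=> n; rewrite mulr_ge0// exprn_ge0.
- move=> n; rewrite /geometric/= mulr_ge0//; last first.
    by rewrite exprn_ge0// divr_ge0// ltW.
  by apply: (le_trans _ (C0 0%N)); rewrite mulr_ge0// exprn_ge0// ltW.
- move=> n; rewrite /geometric/= expr_div_n mulrA ler_pdivlMr ?exprn_gt0//.
  by rewrite mulrAC ler_wpM2r ?exprn_ge0.
- apply: is_cvg_geometric_series; rewrite ger0_norm; last first.
    by rewrite divr_ge0// ltW.
  by rewrite ltr_pdivrMr// mul1r /s; lra.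
Qed.

Lemma ball_summable_le a b (C : R) : ball_summable a ->
  (forall n, `|b n| <= C * `|a n|) -> ball_summable b.
Proof.
move=> ha hb r r0 r1; have := is_cvg_seriesZ (k := C) (ha r r0 r1).
apply: series_le_cvg => n.
- by rewrite mulr_ge0// exprn_ge0.
- rewrite /= [X in _ <= X]mulrA mulr_ge0 ?exprn_ge0//.
  by rewrite (le_trans _ (hb n)).
- by rewrite [X in _ <= X]mulrA ler_wpM2r ?exprn_ge0.
Qed.

Lemma ball_summableD a b : ball_summable a -> ball_summable b ->
  ball_summable (fun n => a n + b n).
Proof.
move=> ha hb r r0 r1; have := is_cvg_seriesD (ha r r0 r1) (hb r r0 r1).
apply: series_le_cvg => n.
- by rewrite mulr_ge0// exprn_ge0.
- by rewrite /= addr_ge0// mulr_ge0// exprn_ge0.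
- by rewrite /= -[leRHS]mulrDl ler_wpM2r ?exprn_ge0// ler_normD.
Qed.

Lemma ball_summableM_r a (u : H) : ball_summable a ->
  ball_summable (fun n => a n * u).
Proof.
move=> ha; apply: (@ball_summable_le _ _ `|u| ha) => n.
by rewrite qnormM mulrC.
Qed.

Lemma ball_summable_conj a : ball_summable a ->
  ball_summable (fun n => quat_conj (a n)).
Proof.
by move=> ha; apply: (@ball_summable_le _ _ 1 ha) => n; rewrite qnorm_conj mul1r.
Qed.

Lemma ball_summable_bounded a (C : R) : (forall n, `|a n| <= C) ->
  ball_summable a.
Proof.
move=> aC r r0 r1; apply: (@series_le_cvg _ _ (geometric C r)).
- by move=> n; rewrite mulr_ge0// exprn_ge0.
- move=> n; rewrite /geometric/= mulr_ge0 ?exprn_ge0//.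
  by apply: le_trans (aC 0%N).
- by move=> n; rewrite /geometric/= ler_wpM2r ?exprn_ge0.
- by apply: is_cvg_geometric_series; rewrite ger0_norm.
Qed.

Lemma ball_summable_conv a b : ball_summable a -> ball_summable b ->
  ball_summable (qconv a b).
Proof.
move=> ha hb r r0 r1.
have [+ _] := @cauchy_product_ge0 _ (fun n => `|a n| * r ^+ n)
  (fun n => `|b n| * r ^+ n) (fun n => mulr_ge0 (normr_ge0 _) (exprn_ge0 _ r0))
  (fun n => mulr_ge0 (normr_ge0 _) (exprn_ge0 _ r0)) (ha r r0 r1) (hb r r0 r1).
apply: series_le_cvg => n.
- by rewrite mulr_ge0// exprn_ge0.
- by apply: sumr_ge0 => k _; rewrite !mulr_ge0// exprn_ge0.
- apply: (le_trans (ler_wpM2r (exprn_ge0 _ r0) (ler_norm_sum _ _ _))).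
  rewrite mulr_suml; apply: ler_sum => k _.
  rewrite qnormM mulrACA -exprD subnKC//; exact: leq_ord.
Qed.

(** If q commutes with the a_k, then q^n a_k b_(n-k) = (q^k a_k) (q^(n-k) b_(n-k)), so the regular
    product is a Cauchy product at q. Every real q qualifies. *)
Lemma qsum_conv a b q : ball_summable a -> ball_summable b -> qball q ->
  (forall n, q * a n = a n * q) -> qsum (qconv a b) q = qsum a q * qsum b q.
Proof.
move=> ha hb qb qa; apply: cvg_lim => //.
have qak m k : a k * q ^+ m = q ^+ m * a k.
  by apply: commrX; apply/esym; exact: qa.
have E : (fun n => \sum_(k < n.+1) q ^+ k * a k * (q ^+ (n - k) * b (n - k)%N)) =
    fun n => q ^+ n * qconv a b n.
  apply/funext => n; rewrite mulr_sumr; apply: eq_bigr => k _.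
  by rewrite mulrA -(mulrA (q ^+ k)) qak !mulrA -exprD subnKC// -ltnS.
have := qcauchy_product (ball_summable_abs ha qb) (ball_summable_abs hb qb).
by rewrite E.
Qed.

Lemma qsum_conv_real a b (t : R) : ball_summable a -> ball_summable b ->
  `|t| < 1 -> qsum (qconv a b) t%:A = qsum a t%:A * qsum b t%:A.
Proof.
move=> ha hb tb; apply: qsum_conv => //; first exact/qball_real.
by move=> n; rewrite qA_comm.
Qed.

Lemma qsumD a b q : ball_summable a -> ball_summable b -> qball q ->
  qsum (fun n => a n + b n) q = qsum a q + qsum b q.
Proof.
move=> ha hb qb; apply: cvg_lim => //.
have -> : qseries (fun n => a n + b n) q = qseries a q + qseries b q.
  rewrite /qseries -seriesD; congr series; apply/funext => n; exact: mulrDr.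
by apply: cvgD; exact: qsum_cvg.
Qed.

Lemma qsumM_r a (u : H) q : ball_summable a -> qball q ->
  qsum (fun n => a n * u) q = qsum a q * u.
Proof.
move=> ha qb; apply: cvg_lim => //.
have -> : qseries (fun n => a n * u) q = fun n => qseries a q n * u.
  apply/funext => n; rewrite /qseries /series /= mulr_suml.
  by apply: eq_bigr => i _; rewrite mulrA.
by apply: qcvgM; [exact: qsum_cvg|exact: cvg_cst].
Qed.

Lemma qsum_conj_real a (t : R) : ball_summable a -> `|t| < 1 ->
  qsum (fun n => quat_conj (a n)) t%:A = quat_conj (qsum a t%:A).
Proof.
move=> ha /qball_real tb; apply: cvg_lim => //.
have -> : qseries (fun n => quat_conj (a n)) t%:A =
    fun n => quat_conj (qseries a t%:A n).
  apply/funext => n; rewrite /qseries /series /= qconj_sum.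
  by apply: eq_bigr => i _; rewrite qconjM qA_exp qconjZ qconj1 qA_comm.
by apply: qcvg_conj; exact: qsum_cvg.
Qed.

Lemma qexpansion_finite (N : nat) a : (forall n, (N <= n)%N -> a n = 0) ->
  qexpansion (fun q => \sum_(0 <= n < N) q ^+ n * a n) a.
Proof.
move=> a0 q _; apply: cvg_near_cst; exists N => // n /= Nn.
rewrite /qseries /series/= (big_cat_nat (leq0n N) Nn)/=.
rewrite -[RHS]addr0; congr (_ + _); rewrite big_nat_cond big1// => i.
by move=> /andP[/andP[Ni _] _]; rewrite a0// mulr0.
Qed.

End BallSummable.

(** * Uniqueness of expansions and the regular reciprocal *)

Section Identity.
Context {R : realType}.
Local Notation H := (quat R).
Implicit Types (a b : nat -> H) (f g : H -> H).

Lemma near0_lt1 : \forall t \near (0 : R)^'+, `|t| < 1.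
Proof.
near=> t; rewrite ger0_norm; last by near: t; exact: nbhs_right_ge.
by near: t; exact: nbhs_right_lt.
Unshelve. all: by end_near. Qed.

(** Strong induction on m: once the lower coefficients vanish, t^m a_m is minus the tail beyond m.
    For t < 1/2 and i > m, t^i <= t^(m+1) 2^(m+1) 2^(-i), so |a_m| <= t 2^(m+1) C, where C is the
    sum of the |a_n| 2^(-n). Then t tends to 0. *)
Lemma qsum_near0_eq0 a : ball_summable a ->
  (\forall t \near 0^'+, qsum a t%:A = 0) -> forall n, a n = 0.
Proof.
move=> ha a0 m; elim/ltn_ind: m => m IH; apply/eqP; rewrite -normr_le0.
have hh : cvgn (series (fun n => `|a n| * (2^-1 : R) ^+ n)) by apply: ha; lra.
set u := series _ in hh; set C := limn u.
have uC n : u n <= C.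
  apply: nondecreasing_cvgn_le => //; apply: nondecreasing_series => k _ _.
  by rewrite mulr_ge0// exprn_ge0.
have t0 : t * (2 ^+ m.+1 * C) @[t --> (0 : R)^'+] --> 0.
  rewrite -[X in _ --> X](mul0r (2 ^+ m.+1 * C)).
  by apply: cvgM; [exact: cvg_at_right_filter cvg_id|exact: cvg_cst].
apply: (cvgr_to_ge t0); near=> t.
have tgt0 : 0 < t by near: t; exact: nbhs_right_gt.
have tlt : t < 2^-1 by near: t; apply: nbhs_right_lt; lra.
have tb : qball (t%:A : H) by apply/qball_real; near: t; exact: near0_lt1.
have ct : qseries a t%:A n @[n --> \oo] --> (0 : H).
  rewrite -(_ : qsum a t%:A = 0); first exact: qsum_cvg.
  by near: t.
have {}ct : `|t ^+ m *: a m - qseries a t%:A n| @[n --> \oo] --> `|t ^+ m *: a m|.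
  apply: cvg_norm; have := cvgB (cvg_cst (t ^+ m *: a m)) ct.
  by rewrite subr0; apply.
rewrite -(ler_pM2l (exprn_gt0 m tgt0)) -[X in X * _ <= _](gtr0_norm (exprn_gt0 m tgt0)).
rewrite -normrZ [leRHS](_ : _ = t ^+ m.+1 * 2 ^+ m.+1 * C); last first.
  by rewrite (exprSr t); ring.
apply: (cvgr_to_le ct); exists m.+1 => // n /= mn.
rewrite /qseries /series/= (big_cat_nat (leq0n m.+1) mn)/= big_nat_recr//=.
rewrite big_nat_cond big1 ?add0r; last first.
  by move=> i /andP[/andP[_ im] _]; rewrite IH// mulr0.
rewrite qA_exp -scalerAl mul1r opprD addNKr normrN.
apply: (le_trans (ler_norm_sum _ _ _)).
apply: (@le_trans _ _ (\sum_(m.+1 <= i < n)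
  (t ^+ m.+1 * 2 ^+ m.+1) * (`|a i| * 2^-1 ^+ i))).
  rewrite big_nat_cond [leRHS]big_nat_cond; apply: ler_sum => i /andP[/andP[mi _] _].
  rewrite qterm_norm qnormA (gtr0_norm tgt0) mulrCA ler_wpM2l//.
  rewrite -(subnKC mi) !exprD exprVn.
  rewrite -mulrA ler_wpM2l ?exprn_ge0 ?(ltW tgt0)//.
  rewrite mulrA divff ?mul1r ?expf_neq0// ?pnatr_eq0//.
  by rewrite lerXn2r ?nnegrE ?(ltW tgt0) ?(ltW tlt)//.
rewrite -mulr_sumr ler_wpM2l ?mulr_ge0 ?exprn_ge0 ?(ltW tgt0)//.
apply: le_trans (uC n); rewrite /u /series/= (big_cat_nat (leq0n m.+1) mn)/= lerDr.
by apply: sumr_ge0 => i _; rewrite mulr_ge0// exprn_ge0.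
Unshelve. all: by end_near. Qed.

Lemma qsum_near0_inj a b : ball_summable a -> ball_summable b ->
  (\forall t \near 0^'+, qsum a t%:A = qsum b t%:A) -> a = b.
Proof.
move=> ha hb ab; apply/funext => n; apply/eqP; rewrite -subr_eq0 -mulrN1; apply/eqP.
have hb' := ball_summableM_r (u := -1) hb.
apply: (qsum_near0_eq0 (ball_summableD ha hb')); near=> t.
have tb : qball (t%:A : H) by apply/qball_real; near: t; exact: near0_lt1.
by rewrite qsumD// qsumM_r// mulrN1 (_ : qsum a t%:A = qsum b t%:A) ?subrr//; near: t.
Unshelve. all: by end_near. Qed.

(** Uniqueness frees [qcoef] from the arbitrary choice made by [xget]. *)
Lemma qcoefE f a : qexpansion f a -> qcoef f = a.
Proof.
move=> fa; have fc : qexpansion f (qcoef f).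
  by apply: (@xgetPex _ (fun=> 0) [set a | qexpansion f a]); exists a.
apply: qsum_near0_inj; [exact: qexpansion_summable fc|exact: qexpansion_summable fa|].
near=> t; have tb : qball (t%:A : H) by apply/qball_real; near: t; exact: near0_lt1.
by rewrite (qsum_qexpansion fc)// (qsum_qexpansion fa).
Unshelve. all: by end_near. Qed.

Lemma rprodE f g a b q : qexpansion f a -> qexpansion g b ->
  rprod f g q = qsum (qconv a b) q.
Proof. by move=> fa gb; rewrite /rprod (qcoefE fa) (qcoefE gb). Qed.

Lemma rconj_expansion f a : qexpansion f a ->
  qexpansion (rconj f) (fun n => quat_conj (a n)).
Proof.
move=> fa; rewrite /rconj (qcoefE fa); apply: qexpansion_qsum.
exact/ball_summable_conj/(qexpansion_summable fa).
Qed.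

(** The reversal k -> n - k takes each term to its conjugate. So the symmetrization has real
    coefficients, which commute with everything. *)
Lemma qconv_conj_real a n : quat_conj (qconv a (fun k => quat_conj (a k)) n) =
  qconv a (fun k => quat_conj (a k)) n.
Proof.
rewrite /qconv qconj_sum (reindex_inj rev_ord_inj)/=; apply: eq_bigr => k _.
by rewrite qconjM qconjK subSS subKn// -ltnS.
Qed.

Lemma qconv_conj_comm a n (q : H) :
  q * qconv a (fun k => quat_conj (a k)) n = qconv a (fun k => quat_conj (a k)) n * q.
Proof. by rewrite (qconj_real (qconv_conj_real a n)) qA_comm. Qed.

Lemma qsum_conv_conj_real a (t : R) : ball_summable a -> `|t| < 1 ->
  qsum (qconv a (fun k => quat_conj (a k))) t%:A = (`|qsum a t%:A| ^+ 2)%:A.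
Proof.
move=> ha t1; have hc := ball_summable_conj ha.
by rewrite qsum_conv_real// qsum_conj_real// qmul_conjr.
Qed.

(** At real points the symmetrization is |g|^2 and the regular conjugate is conj g, whose quotient
    is the inverse of g. *)
Lemma rrecip_real g a (t : R) : qexpansion g a -> `|t| < 1 ->
  rrecip g t%:A = (g t%:A)^-1.
Proof.
move=> ga t1; have ha := qexpansion_summable ga.
have tb : qball (t%:A : H) by exact/qball_real.
rewrite /rrecip /symmetrization (rprodE _ ga (rconj_expansion ga)).
rewrite qsum_conv_conj_real// /rconj (qcoefE ga) qsum_conj_real//.
rewrite (qsum_qexpansion ga)//; set p := g _.
(* At a zero of [g] both sides are 0, by the convention 0^-1 = 0. *)
have [->|p0] := eqVneq p 0; first by rewrite qconj0 mulr0 invr0.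
have n0 : `|p| != 0 by rewrite normr_eq0.
rewrite !qinvE qconjZ qconj1 qnormA -scalerAl mulr_algl scalerA.
by congr (_ *: _); rewrite normrX normr_id; field.
Qed.

(* With [s = g * g^c] and [t = h * h^c], both with real coefficients, [s * t = 1]
   shows that the symmetrization does not vanish on the ball. *)
Lemma rrecip_expansion g a h : qexpansion g a -> ball_summable h ->
  (\forall t \near 0^'+, g t%:A * qsum h t%:A = 1) -> qexpansion (rrecip g) h.
Proof.
move=> ga hh gh; have ha := qexpansion_summable ga.
have hac := ball_summable_conj ha; have hhc := ball_summable_conj hh.
set ac := (fun n => quat_conj (a n)) in hac.
set hc := (fun n => quat_conj (h n)) in hhc.
have hs := ball_summable_conv ha hac; have ht := ball_summable_conv hh hhc.
have one n : (0 < n)%N -> [:: 1 : H]`_n = 0.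
  by case: n => [|n] //= _; rewrite nth_nil.
have one_exp := @qexpansion_finite _ 1 _ one.
have one_sum := qexpansion_summable one_exp.
have st : qconv (qconv a ac) (qconv h hc) = (fun n => [:: 1 : H]`_n).
  apply: qsum_near0_inj => //; first exact: ball_summable_conv.
  near=> t; have t1 : `|t| < 1 by near: t; exact: near0_lt1.
  have tb : qball (t%:A : H) by exact/qball_real.
  rewrite qsum_conv_real// !qsum_conv_conj_real// (qsum_qexpansion one_exp)//.
  rewrite (qsum_qexpansion ga)// big_nat1 expr0 mulr1 -scalerAl mul1r scalerA.
  rewrite -exprMn -qnormM (_ : g t%:A * _ = 1) ?qnorm1 ?expr1n ?scale1r//.
  by near: t.
(* At small real t, |g|^2 h = conj(g) g h = conj(g). *)
have sh : qconv (qconv a ac) h = ac.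
  apply: qsum_near0_inj => //; first exact: ball_summable_conv.
  near=> t; have t1 : `|t| < 1 by near: t; exact: near0_lt1.
  have tb : qball (t%:A : H) by exact/qball_real.
  rewrite qsum_conv_real// qsum_conv_conj_real// qsum_conj_real//.
  rewrite (qsum_qexpansion ga)// -qmul_conjl -mulrA (_ : g t%:A * _ = 1) ?mulr1//.
  by near: t.
move=> q qb; suff -> : rrecip g q = qsum h q by exact: qsum_cvg.
(* Real coefficients commute with every [q], so the two identities between convolutions become
   pointwise on the whole ball, not only at real points. *)
have comm n : q * qconv a ac n = qconv a ac n * q by exact: qconv_conj_comm.
have ST : qsum (qconv a ac) q * qsum (qconv h hc) q = 1.
  rewrite -qsum_conv// st (qsum_qexpansion one_exp)//.
  by rewrite big_nat1 expr0 mulr1.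
have SH : qsum (qconv a ac) q * qsum h q = qsum ac q by rewrite -qsum_conv// sh.
rewrite /rrecip /symmetrization (rprodE _ ga (rconj_expansion ga)) -/ac.
rewrite /rconj (qcoefE ga) -/ac -SH mulrA mulVr ?mul1r// qunitE.
apply/eqP => S0; move: ST; rewrite S0 mul0r => /eqP.
by rewrite eq_sym oner_eq0.
Unshelve. all: by end_near. Qed.

End Identity.

(** * Accretivity *)

Section RootsOfUnity.
Context {R : realType}.

Lemma cos_sin_natmul_2pi (n : nat) :
  cos (n%:R * (pi *+ 2)) = 1 :> R /\ sin (n%:R * (pi *+ 2)) = 0 :> R.
Proof.
move: (@cos2pi R) (@sin2pi R); move: (pi *+ 2) => y c2 s2.
elim: n => [|n [IHc IHs]]; first by rewrite mul0r cos0 sin0.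
rewrite -natr1 mulrDl mul1r cosD sinD IHc IHs c2 s2.
by rewrite !mulr0 !mul0r mulr1 subr0 addr0.
Qed.

(** Let C + iS be the sum of the e^(ilx). Multiplication by e^(ix) permutes the terms cyclically,
    since e^(iNx) = 1, so (1 - e^(ix)) (C + iS) = 0. *)
Lemma sum_cos_eq0 (N : nat) (x : R) : cos (N%:R * x) = 1 -> sin (N%:R * x) = 0 ->
  cos x != 1 -> \sum_(0 <= l < N) cos (l%:R * x) = 0.
Proof.
move=> cN sN c1; set C := \sum_(0 <= l < N) _.
set S := \sum_(0 <= l < N) sin (l%:R * x).
have shift (h : nat -> R) : h N = h 0%N ->
    \sum_(0 <= l < N) h l.+1 = \sum_(0 <= l < N) h l.
  move=> hN; apply/eqP; rewrite -subr_eq0 -sumrB.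
  by rewrite telescope_sumr// hN subrr.
have eC : C * cos x - S * sin x = C.
  rewrite -[RHS](shift (fun l => cos (l%:R * x))); last by rewrite cN mul0r cos0.
  rewrite /C /S !mulr_suml -sumrB; apply: eq_bigr => l _.
  by rewrite -natr1 mulrDl mul1r cosD.
have eS : S * cos x + C * sin x = S.
  rewrite -[RHS](shift (fun l => sin (l%:R * x))); last by rewrite sN mul0r sin0.
  rewrite /C /S !mulr_suml -big_split; apply: eq_bigr => l _ /=.
  by rewrite -natr1 mulrDl mul1r sinD.
(* The conjugate of 1 - e^(ix) times the vanishing product has real part |1 - e^(ix)|^2 C, and |1 -
   e^(ix)|^2 = 2 (1 - cos x). *)
have cs := cos2Dsin2 x; have /eqP : 2 * (1 - cos x) * C = 0.
  have -> : 2 * (1 - cos x) * C = (C - (C * cos x - S * sin x)) * (1 - cos x)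
     - (S - (S * cos x + C * sin x)) * sin x
     - (cos x ^+ 2 + sin x ^+ 2 - 1) * C by ring.
  rewrite eC eS cs !subrr !mul0r.
  by rewrite !subr0.
by rewrite !mulf_eq0 pnatr_eq0 subr_eq0 [1 == _]eq_sym (negbTE c1) => /eqP.
Qed.

(** Discrete orthogonality: both indices are below N, so p - j is a multiple of N only if it is
    0. *)
Lemma sum_cos_roots (N p j : nat) : (p < N)%N -> (j < N)%N ->
  \sum_(0 <= l < N) cos (l%:R * ((p%:R - j%:R) * (pi *+ 2 / N%:R))) =
  if p == j then N%:R else 0 :> R.
Proof.
wlog jp : p j / (j <= p)%N => [wl pN jN|pN jN].
  have [|/ltnW pj] := leqP j p; first by move=> jp; exact: wl.
  rewrite eq_sym -wl//; apply: eq_bigr => l _.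
  by rewrite -cosN -mulrN -mulNr opprB.
have [->|npj] := eqVneq p j.
  rewrite (eq_bigr (fun=> 1)).
    by rewrite sumr_const_nat subn0.
  by move=> l _; rewrite subrr mul0r mulr0 cos0.
have N0 : (N%:R : R) != 0 by rewrite pnatr_eq0; lia.
have E : N%:R * ((p%:R - j%:R) * (pi *+ 2 / N%:R)) = (p - j)%N%:R * (pi *+ 2) :> R.
  by rewrite natrB//; field.
have [c1 s1] := cos_sin_natmul_2pi (p - j).
apply: sum_cos_eq0; rewrite ?E//.
(* Half of the angle: 0 < y < pi gives sin y > 0, and cos(2y) = 1 - 2 sin(y)^2 differs from 1. *)
set y : R := (p%:R - j%:R) * (pi / N%:R).
have -> : (p%:R - j%:R) * (pi *+ 2 / N%:R) = y *+ 2 :> R by rewrite /y; field.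
have y0 : 0 < sin y.
  apply: sin_gt0_pi; rewrite /y -natrB//.
  have Np : (0 : R) < N%:R by rewrite lt0r N0 ler0n.
  apply/andP; split.
    by apply: mulr_gt0; [rewrite ltr0n; lia|exact: divr_gt0 (pi_gt0 R) Np].
  by rewrite mulrA ltr_pdivrMr// mulrC ltr_pM2l ?pi_gt0// ltr_nat; lia.
rewrite cos_mulr2n cos2sin2; apply/eqP => h.
have : sin y ^+ 2 = 0 by lra.
by move/eqP; rewrite sqrf_eq0 gt_eqF.
Qed.

End RootsOfUnity.

(** * The accretive form for trigonometric polynomials *)

Section Accretivity.
Context {R : realType}.
Local Notation H := (quat R).

Lemma qre_conj_sandwich (b X : H) :
  qre (quat_conj X * b * X) = `|X| ^+ 2 * qre b.
Proof. by rewrite qreM_sym mulrA qmul_conjr mulr_algl. Qed.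

(* The right-hand side is [Re v^* (b + i g) v] for [v = X + i Y] in the
   complexified quaternions; testing [I = V / |V|] with [V = X Y^* - Y X^*]
   shows that it is nonnegative. *)
Lemma hermitian_slice_ge0 (b g X Y : H) :
  (forall I : H, quat_conj I = - I -> `|I| = 1 -> 0 <= qre (b + I * g)) ->
  0 <= qre (quat_conj X * b * X) + qre (quat_conj Y * b * Y) +
       (qre (quat_conj Y * g * X) - qre (quat_conj X * g * Y)).
Proof.
move=> h; rewrite !qre_conj_sandwich; set V := X * quat_conj Y - Y * quat_conj X.
have -> : qre (quat_conj Y * g * X) - qre (quat_conj X * g * Y) = qre (V * g).
  rewrite (qreM_sym _ X) (qreM_sym _ Y) -qreB !mulrA.
  by rewrite -mulrBl.
have cV : quat_conj V = - V by rewrite qconjD qconjN !qconjM !qconjK opprB.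
have nV : `|V| <= `|X| ^+ 2 + `|Y| ^+ 2.
  apply: (le_trans (ler_normB _ _)); rewrite !qnormM !qnorm_conj.
  by have := sqr_ge0 (`|X| - `|Y|); lra.
(* The hypothesis at i and at -i adds up to 2 Re b >= 0. *)
have b0 : 0 <= qre b.
  pose i : H := Quat 0 1 0 0.
  have ci : quat_conj i = - i by apply: quatP => /=; ring.
  have ni : `|i| = 1.
    by rewrite qnormE /quat_norm /quat_sqnorm /= expr1n expr0n /= !addr0 add0r sqrtr1.
  have := h i ci ni; have := h (- i); rewrite qconjN ci normrN ni.
  by move=> /(_ erefl erefl); rewrite !qreD mulNr qreN; lra.
have [V0|V0] := eqVneq V 0.
  by rewrite V0 mul0r addr0 -mulrDl mulr_ge0// addr_ge0// sqr_ge0.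
have V0' : 0 < `|V| by rewrite normr_gt0.
have := h (`|V|^-1 *: V); rewrite qconjZ cV scalerN normrZ normfV normr_id.
rewrite mulVf ?gt_eqF// => /(_ erefl erefl).
rewrite -scalerAl qreD qreZ => h1.
have : 0 <= `|V| * qre b + qre (V * g).
  have := mulr_ge0 (ltW V0') h1.
  by rewrite mulrDr mulrA divff ?gt_eqF// mul1r.
(* As Re b >= 0, the factor |V| may be replaced by the larger |X|^2 + |Y|^2. *)
by have := ler_wpM2r b0 nV; lra.
Qed.

Lemma qre_triple_sum (n M : nat) (a c : nat -> H) (x y z : nat -> R) :
  qre (quat_conj (\sum_(j < n) x j *: c j) * (\sum_(m < M) y m *: a m) *
    (\sum_(k < n) z k *: c k)) =
  \sum_(j < n) \sum_(m < M) \sum_(k < n)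
    x j * y m * z k * qre (quat_conj (c j) * a m * c k).
Proof.
rewrite qconj_sum !mulr_suml qre_sum; apply: eq_bigr => j _.
rewrite -mulrA mulr_suml mulr_sumr qre_sum; apply: eq_bigr => m _.
rewrite !mulr_sumr qre_sum; apply: eq_bigr => k _.
rewrite mulrA qconjZ -!scalerAl -!scalerAr -!scalerAl !scalerA qreZ.
by congr (_ * _); ring.
Qed.

(** For m <= j the only k with m + k = j is j - m, which is below n since j is; for m > j there is
    none. The condition n <= M ensures that all m <= j occur. *)
Lemma qconv_re_sum (n M : nat) (a c : nat -> H) (j : 'I_n) : (n <= M)%N ->
  \sum_(m < M) \sum_(k < n)
    (if (m + k)%N == j then qre (quat_conj (c j) * a m * c k) else 0) =
  qre (quat_conj (c j) * qconv a c j).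
Proof.
move=> nM; rewrite /qconv mulr_sumr qre_sum.
have jM : (j.+1 <= M)%N by apply: leq_trans nM.
rewrite (big_ord_widen M (fun m => qre (quat_conj (c j) * (a m * c (j - m)%N))) jM).
rewrite [RHS]big_mkcond; apply: eq_bigr => m _.
rewrite -big_mkcond/=; case: ifPn => [mj|mj]; last first.
  by rewrite big_pred0// => k; lia.
have jm : (j - m < n)%N by have := ltn_ord j; lia.
rewrite (big_pred1 (Ordinal jm)) ?mulrA// => k.
apply/eqP/eqP => [mkj|->]; last by rewrite /=; lia.
by apply: val_inj => /=; lia.
Qed.

(** Apply [hermitian_slice_ge0] with b and g the cosine and sine sums of [a], and X and Y those of
    [c]. The value is the sum of the cos((m + k - j) x) Re(conj(c_j) a_m c_k), and averaging over x
    = 2 pi l / N keeps only the terms with m + k = j. *)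
Lemma accretive_trig_poly (n M : nat) (a c : nat -> H) : (n <= M)%N ->
  (forall (x : R) (I : H), quat_conj I = - I -> `|I| = 1 ->
    0 <= qre (\sum_(m < M) (cos (m%:R * x) *: a m + I * (sin (m%:R * x) *: a m)))) ->
  0 <= \sum_(j < n) qre (quat_conj (c j) * qconv a c j).
Proof.
(* Both m + k and j are below this [N], so no nonzero frequency m + k - j is confused with 0. *)
move=> nM h; pose N := (M + n)%N.
pose E (x : R) := \sum_(j < n) \sum_(m < M) \sum_(k < n)
  cos (((m + k)%:R - j%:R) * x) * qre (quat_conj (c j) * a m * c k).
have E0 x : 0 <= E x.
  pose C (j : nat) := cos (j%:R * x); pose S (j : nat) := sin (j%:R * x).
  have cE (m k j : nat) : cos (((m + k)%:R - j%:R) * x) =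
      (C m * C k - S m * S k) * C j + (S m * C k + C m * S k) * S j.
    by rewrite mulrBl cosB natrD mulrDl cosD sinD.
  have prem I : quat_conj I = - I -> `|I| = 1 ->
      0 <= qre (\sum_(m < M) C m *: a m + I * \sum_(m < M) S m *: a m).
    by move=> cI nI; have := h x I cI nI; rewrite big_split -mulr_sumr.
  have := hermitian_slice_ge0 (\sum_(k < n) C k *: c k) (\sum_(k < n) S k *: c k) prem.
  rewrite (@qre_triple_sum n M a c C C C) (@qre_triple_sum n M a c S C S).
  rewrite (@qre_triple_sum n M a c S S C) (@qre_triple_sum n M a c C S S).
  congr (0 <= _); rewrite -sumrB -!big_split /=; apply: eq_bigr => j _.
  rewrite -sumrB -!big_split /=; apply: eq_bigr => m _.
  rewrite -sumrB -!big_split /=; apply: eq_bigr => k _.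
  rewrite cE; move: (qre _) => t; rewrite /C /S; ring.
have sumE : \sum_(0 <= l < N) E (l%:R * (pi *+ 2 / N%:R)) =
    N%:R * \sum_(j < n) qre (quat_conj (c j) * qconv a c j).
  rewrite exchange_big mulr_sumr; apply: eq_bigr => j _ /=.
  rewrite -(qconv_re_sum _ _ _ nM) exchange_big mulr_sumr; apply: eq_bigr => m _ /=.
  rewrite exchange_big mulr_sumr; apply: eq_bigr => k _ /=.
  rewrite -mulr_suml.
  have mkN : (m + k < N)%N by have := ltn_ord m; have := ltn_ord k; rewrite /N; lia.
  have jN : (j < N)%N by have := ltn_ord j; rewrite /N; lia.
  have := sum_cos_roots mkN jN; under eq_bigr do rewrite mulrCA.
  by move=> ->; case: ifP => _; rewrite ?mul0r ?mulr0.
have [n0|n0] := posnP n.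
  by rewrite big1// => j _; exfalso; have := ltn_ord j; lia.
have N0 : (0 : R) < N%:R by rewrite ltr0n /N; lia.
by rewrite -(pmulr_rge0 _ N0) -sumE; apply: sumr_ge0 => l _; exact: E0.
Qed.

End Accretivity.

(** * From trigonometric polynomials to power series on the ball *)

Section Polar.
Context {R : realType}.
Local Notation H := (quat R).

Section ImaginaryUnit.
Variables (I : H) (cI : quat_conj I = - I) (nI : `|I| = 1).

Lemma imag_sqr : I * I = -1.
Proof.
have := qmul_conjr I; rewrite cI nI expr1n scale1r mulrN => <-.
by rewrite opprK.
Qed.

Lemma slice_mul (x y z t : R) :
  slice I x y * slice I z t = slice I (x * z - y * t) (x * t + y * z).
Proof.
rewrite /slice mulrDl !mulrDr -!scalerAl -!scalerAr !mul1r !mulr1 imag_sqr.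
by apply: quatP => /=; ring.
Qed.

Lemma slice_norm_sqr (x y : R) : `|slice I x y| ^+ 2 = x ^+ 2 + y ^+ 2.
Proof.
have : qre (slice I x y * quat_conj (slice I x y)) = x ^+ 2 + y ^+ 2.
  rewrite [quat_conj _](_ : _ = slice I x (- y)); last first.
    by rewrite /slice qconjD !qconjZ qconj1 cI scalerN scaleNr.
  rewrite slice_mul /slice [X in X *: I](_ : _ = 0); last by ring.
  by rewrite scale0r addr0 qreZ mulr1; ring.
by rewrite qmul_conjr qreZ mulr1.
Qed.

(** De Moivre's formula in the plane of [I]. *)
Lemma slice_polar_exp (r x : R) n : slice I (r * cos x) (r * sin x) ^+ n =
  r ^+ n *: slice I (cos (n%:R * x)) (sin (n%:R * x)).
Proof.
elim: n => [|n IH].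
  by rewrite !expr0 mul0r cos0 sin0 /slice !scale1r scale0r addr0.
rewrite exprSr IH -scalerAl slice_mul -natr1 mulrDl mul1r cosD sinD /slice.
by rewrite !scalerDr !scalerA exprSr; congr (_ *: _ + _ *: _); ring.
Qed.

End ImaginaryUnit.

(* [Re f > 0] makes the multiplication by [f] accretive: truncate the series on
   the sphere of radius [r], at the cost of an error [e] in the constant
   coefficient, then let [e] tend to 0 and [r] to 1. *)
Lemma accretive_of_qre_ge0 (f : H -> H) (a : nat -> H) : qexpansion f a ->
  (forall q, qball q -> 0 <= qre (f q)) -> forall n (c : nat -> H),
  0 <= \sum_(j < n) qre (quat_conj (c j) * qconv a c j).
Proof.
move=> fa f0 n c; have ha := qexpansion_summable fa.
pose Q (r : R) := \sum_(j < n) \sum_(k < j.+1)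
  r ^+ k * qre (quat_conj (c j) * (a k * c (j - k)%N)).
have QE r : \sum_(j < n) qre (quat_conj (c j) * qconv (fun k => r ^+ k *: a k) c j) = Q r.
  apply: eq_bigr => j _; rewrite /qconv mulr_sumr qre_sum; apply: eq_bigr => k _.
  by rewrite -scalerAl -scalerAr qreZ.
have Q0 (r : R) : 0 < r -> r < 1 -> 0 <= Q r.
  move=> r0 r1; apply/ler_addgt0Pr => e e0.
  set K := \sum_(j < n) `|c j| ^+ 2.
  have K0 : 0 <= K by apply: sumr_ge0 => j _; exact: sqr_ge0.
  (* Adding [d] to the constant coefficient adds d K <= e to the form; K + 1 keeps the denominator
     positive. *)
  set d := e / (K + 1); have d0 : 0 < d by apply: divr_gt0 => //; lra.
  have dK : d * K <= e by rewrite /d mulrAC ler_pdivrMr; [rewrite ler_pM2l; lra|lra].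
  suff : 0 <= Q r + d * K by lra.
  have cu := ha r (ltW r0) r1; set u := series _ in cu; set L := limn u.
  have uL m : u m <= L.
    apply: nondecreasing_cvgn_le => //; apply: nondecreasing_series => k _ _.
    by rewrite mulr_ge0// exprn_ge0// ltW.
  (* [M] makes the tail of the sum of the |a_n| r^n at most [d], and exceeds [n], so that
     [accretive_trig_poly] applies and the truncation retains the constant term. *)
  have [M nM uM] : exists2 M, (n.+1 <= M)%N & L - d <= u M.
    have /cvgrPdist_le/(_ d d0)[N _ hN] := cu.
    exists (maxn N n.+1); first exact: leq_maxr.
    have : `|L - u (maxn N n.+1)| <= d by apply: hN; exact: leq_maxl.
    by rewrite ger0_norm ?subr_ge0// => h; lra.
  have tail (q : H) : `|q| = r -> `|f q - qseries a q M| <= d.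
    move=> qr; have qb : qball q by rewrite /qball/= qr.
    have c1 : `|qseries a q N - qseries a q M| @[N --> \oo] --> `|f q - qseries a q M|.
      by apply: cvg_norm; apply: cvgB; [exact: fa|exact: cvg_cst].
    apply: (cvgr_to_le c1); exists M => // N /= MN.
    rewrite sub_series_geq//; apply: (le_trans (ler_norm_sum _ _ _)).
    apply: (@le_trans _ _ (u N - u M)); last by have := uL N; lra.
    rewrite sub_series_geq//; apply: ler_sum => i _.
    by rewrite qterm_norm qr.
  (* On |q| = r the truncation differs from f by at most [d], so adding [d] to the constant
     coefficient restores a nonnegative real part. *)
  pose al m : H := r ^+ m *: a m + (if m == 0%N then d else 0)%:A.
  have nM' : (n <= M)%N by exact: ltnW.
  have := @accretive_trig_poly _ n M al c nM'.
  have -> : \sum_(j < n) qre (quat_conj (c j) * qconv al c j) = Q r + d * K.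
    rewrite -QE /K mulr_sumr -big_split; apply: eq_bigr => j _ /=.
    have -> : qconv al c j = qconv (fun k => r ^+ k *: a k) c j + d *: c j.
      rewrite /qconv /al; under eq_bigr do rewrite mulrDl.
      rewrite big_split /=; congr (_ + _); rewrite big_ord_recl /= subn0 mulr_algl.
      by rewrite big1 ?addr0// => k _; rewrite scale0r mul0r.
    rewrite mulrDr qreD; congr (_ + _).
    by rewrite -scalerAr qmul_conjl !qreZ mulr1.
  apply => x I cI nI.
  pose q := slice I (r * cos x) (r * sin x).
  have qr : `|q| = r.
    apply/eqP; rewrite -(@eqrXn2 _ 2)// ?(ltW r0)// slice_norm_sqr//.
    by apply/eqP; have := cos2Dsin2 x => h; rewrite !exprMn -mulrDr h mulr1.
  have qb : qball q by rewrite /qball/= qr.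
  have -> : \sum_(m < M) (cos (m%:R * x) *: al m + I * (sin (m%:R * x) *: al m)) =
      qseries a q M + d%:A.
    have M0 : (0 < M)%N by lia.
    transitivity (\sum_(m < M) slice I (cos (m%:R * x)) (sin (m%:R * x)) * al m).
      apply: eq_bigr => m _; rewrite /slice mulrDl -!scalerAl mul1r.
      by rewrite -scalerAr.
    rewrite /al; under eq_bigr do rewrite mulrDr -scalerAr scalerAl -slice_polar_exp//.
    rewrite big_split /= /qseries /series /= big_mkord; congr (_ + _).
    rewrite -(prednK M0) big_ord_recl [X in _ + X]big1 => [|k _]; last first.
      by rewrite scale0r mulr0.
    by rewrite /= mul0r cos0 sin0 /slice scale1r scale0r !addr0 mul1r.
  have := f0 q qb; have := qre_le_norm (f q - qseries a q M).
  have := tail q qr; rewrite !qreD qreN qreZ mulr1 => h1 /ler_normlP[h2 h3] h4.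
  by lra.
(* [Q] is polynomial in r, hence continuous at 1. *)
have cQ : Q r @[r --> (1 : R)^'-] --> Q 1.
  apply: cvg_at_left_filter; apply: cvg_big => [|j _]; first exact: add_continuous.
  apply: cvg_big => [|k _]; first exact: add_continuous.
  by apply: cvgM; [exact: exprn_continuous|exact: cvg_cst].
have <- : Q 1 = \sum_(j < n) qre (quat_conj (c j) * qconv a c j).
  rewrite -QE; apply: eq_bigr => j _; congr (qre (_ * _)).
  by apply: eq_bigr => k _; rewrite expr1n scale1r.
apply: (cvgr_to_ge cQ); near=> r.
apply: Q0; first by near: r; exact: nbhs_left_gt.
by near: r; exact: nbhs_left_lt.
Unshelve. all: by end_near. Qed.

End Polar.

(** * The Moebius factor *)

Section Expansions.
Context {R : realType}.
Local Notation H := (quat R).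
Implicit Types (a b : nat -> H) (f g : H -> H).

Lemma qexpansionD f g a b : qexpansion f a -> qexpansion g b ->
  qexpansion (fun q => f q + g q) (fun n => a n + b n).
Proof.
move=> fa gb q qb; have ha := qexpansion_summable fa.
have hb := qexpansion_summable gb; have := qsum_cvg (ball_summableD ha hb) qb.
by rewrite qsumD// (qsum_qexpansion fa)// (qsum_qexpansion gb).
Qed.

Lemma qexpansionM_r f a (u : H) : qexpansion f a ->
  qexpansion (fun q => f q * u) (fun n => a n * u).
Proof.
move=> fa q qb; have ha := qexpansion_summable fa.
have := qsum_cvg (ball_summableM_r (u := u) ha) qb.
by rewrite qsumM_r// (qsum_qexpansion fa).
Qed.

Lemma eq_qexpansion f g a : qexpansion f a ->
  (forall q, qball q -> f q = g q) -> qexpansion g a.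
Proof. by move=> fa fg q qb; rewrite -fg//; exact: fa. Qed.

Lemma qexpansion_seq (s : seq H) :
  qexpansion (fun q => \sum_(0 <= n < size s) q ^+ n * s`_n) (fun n => s`_n).
Proof. by apply: qexpansion_finite => n; exact: nth_default. Qed.

Lemma qexpansion_cst (x : H) : qexpansion (fun=> x) (fun n => [:: x]`_n).
Proof.
refine (eq_qexpansion (@qexpansion_seq [:: x]) _) => q _.
by rewrite big_nat1 expr0 mul1r.
Qed.

Lemma qexpansion_affine (x y : H) :
  qexpansion (fun q => x + q * y) (fun n => [:: x; y]`_n).
Proof.
refine (eq_qexpansion (@qexpansion_seq [:: x; y]) _) => q _.
by rewrite big_nat_recr//= big_nat1 expr0 mul1r expr1.
Qed.

(** The function q has the real coefficients 0, 1, so the regular product with it on the left is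
    pointwise. *)
Lemma qexpansion_mulX f a : qexpansion f a ->
  qexpansion (fun q => q * f q) (qconv (fun n => [:: 0; 1]`_n) a).
Proof.
move=> fa; have hX := @qexpansion_affine 0 1.
have sX := qexpansion_summable hX; have sa := qexpansion_summable fa.
refine (eq_qexpansion (qexpansion_qsum (ball_summable_conv sX sa)) _) => q qb.
rewrite qsum_conv//; last first.
  by case=> [|[|n]] /=; rewrite ?mulr0 ?mul0r ?mulr1 ?mul1r// nth_nil mulr0 mul0r.
by rewrite (qsum_qexpansion hX)// (qsum_qexpansion fa)// add0r mulr1.
Qed.

End Expansions.

(** * Null vectors of the accretive form *)

Section Kernel.
Context {R : realType}.
Local Notation H := (quat R).

(* Perturb [c] at the single index [j]: the form is affine plus quadratic in the
   perturbation, so its linear part vanishes. *)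
Lemma accretive_kernel (a c : nat -> H) (N : nat) : a 0%N = 1 ->
  (forall n (x : nat -> H), 0 <= \sum_(j < n) qre (quat_conj (x j) * qconv a x j)) ->
  (forall n, (N <= n)%N -> c n = 0) ->
  \sum_(j < N) qre (quat_conj (c j) * qconv a c j) = 0 ->
  forall j, (N <= j)%N -> qconv a c j = 0.
Proof.
move=> a0 acc cN c0 j Nj; set S := qconv a c j.
(* This x minimizes Re(conj(x) (S + x)), with minimum -|S|^2 / 4. *)
have [x xE] : exists x, x = - (2^-1 *: S) by eexists.
have xS : qre (quat_conj x * (S + x)) = - (`|S| ^+ 2 / 4).
  rewrite (_ : S + x = 2^-1 *: S); last by rewrite xE; apply: quatP => /=; field.
  rewrite xE qconjN qconjZ mulNr -scalerAl -scalerAr scalerA qreN qmul_conjl.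
  by rewrite scalerA qreZ mulr1; field.
pose d i := if i == j then x else c i.
have dc i : (i < j)%N -> d i = c i by move=> ij; rewrite /d ltn_eqF.
have dj : d j = x by rewrite /d eqxx.
have convd i : (i < j)%N -> qconv a d i = qconv a c i.
  by move=> ij; apply: eq_bigr => k _; rewrite dc// (leq_ltn_trans _ ij)// leq_subr.
have convj : qconv a d j = S + x.
  rewrite /S /qconv !big_ord_recl /= !subn0 dj a0 !mul1r cN// add0r addrC.
  by congr (_ + _); apply: eq_bigr => k _; rewrite dc//= /bump; have := ltn_ord k; lia.
(* For [d] the rows below N contribute 0 by assumption, and those from N to j - 1 contribute 0
   because [c] vanishes there. Row j leaves 0 <= -|S|^2 / 4. *)
have := acc j.+1 d; rewrite big_ord_recr -[nat_of_ord ord_max]/j convj dj xS.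
rewrite (eq_bigr (fun i : 'I_j => qre (quat_conj (c i) * qconv a c i))); last first.
  by move=> i _; rewrite -[nat_of_ord (widen_ord _ i)]/(nat_of_ord i) convd// dc.
rewrite /= -(big_mkord xpredT (fun i => qre (quat_conj (c i) * qconv a c i))).
rewrite (big_cat_nat (leq0n N) Nj) [X in X + _ + _]big_mkord c0 add0r.
rewrite big_nat_cond big1 ?add0r => [h|i /andP[/andP[Ni _] _]]; last first.
  by rewrite cN// qconj0 mul0r.
by apply/eqP; rewrite -normr_eq0 -sqrf_eq0 eq_le sqr_ge0 andbT; lra.
Qed.

(** The entry [c1] minimizes the form in the middle variable, where completing the square leaves
    -|a1 + conj(a1) u|^2 / 4. Its cross term -Re(conj(u) a1^2) / 2 turns a2 into a2 - a1^2 / 2. *)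
Lemma toeplitz3 (a1 a2 u : H) : let c1 := - (2^-1 *: (a1 + quat_conj a1 * u)) in
  1 + qre (quat_conj c1 * (a1 + c1)) + qre (quat_conj u * (a2 + a1 * c1 + u)) =
  1 + `|u| ^+ 2 - (`|a1| ^+ 2 + `|a1| ^+ 2 * `|u| ^+ 2) / 4 +
  qre (quat_conj u * (a2 - 2^-1 *: a1 ^+ 2)).
Proof.
rewrite /= !qnorm_sqr /quat_sqnorm expr2.
by case: a1 a2 u => a b c d [a' b' c' d'] [e f g h] /=; field.
Qed.

End Kernel.

(** * The expansion of q phi_b(q) u *)

Section Phi.
Context {R : realType}.
Local Notation H := (quat R).
Variables (b : H) (b1 : `|b| <= 1).

Definition phi_coef : nat -> H :=
  qconv (fun n => quat_conj b ^+ n) (fun n => [:: b; -1]`_n).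

Lemma geometric_summable : ball_summable (fun n => quat_conj b ^+ n).
Proof.
apply: (@ball_summable_bounded _ _ 1) => n.
by rewrite qnormX qnorm_conj exprn_ile1.
Qed.

Lemma qexpansion_1_sub_conj :
  qexpansion (fun q => 1 - q * quat_conj b) (fun n => [:: 1; - quat_conj b]`_n).
Proof.
refine (eq_qexpansion (@qexpansion_affine R 1 (- quat_conj b)) _) => q _.
by rewrite mulrN.
Qed.

(** The convolution of 1, -conj b with the powers of conj b telescopes to 1. *)
Lemma geometric_real (t : R) : `|t| < 1 ->
  (1 - t%:A * quat_conj b) * qsum (fun n => quat_conj b ^+ n) t%:A = 1.
Proof.
move=> t1; have tb : qball (t%:A : H) by exact/qball_real.
have hg := qexpansion_1_sub_conj; have sg := qexpansion_summable hg.
rewrite -(qsum_qexpansion hg)// -qsum_conv_real//; last exact: geometric_summable.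
rewrite (_ : qconv _ _ = fun n => [:: 1]`_n).
  by rewrite (qsum_qexpansion (@qexpansion_cst R 1)).
apply/funext => -[|n]; rewrite /qconv.
  by rewrite big_ord_recl big_ord0 /= expr0 mulr1 addr0.
rewrite !big_ord_recl big1 => [|k _]; last by rewrite /= nth_nil mul0r.
by rewrite /= nth_nil addr0 subn0 mul1r mulNr subSS subn0 -exprS subrr.
Qed.

Lemma rrecip_1_sub_conj : qexpansion (rrecip (fun q => 1 - q * quat_conj b))
  (fun n => quat_conj b ^+ n).
Proof.
apply: rrecip_expansion qexpansion_1_sub_conj geometric_summable _; near=> t.
by apply: geometric_real; near: t; exact: near0_lt1.
Unshelve. all: by end_near. Qed.

Lemma qexpansion_sub : qexpansion (fun q => b - q) (fun n => [:: b; -1]`_n).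
Proof.
refine (eq_qexpansion (@qexpansion_affine R b (-1)) _) => q _.
by rewrite mulrN1.
Qed.

Lemma phi_expansion : qexpansion (phi b) phi_coef.
Proof.
have e1 := rrecip_1_sub_conj; have e2 := qexpansion_sub.
have := qexpansion_qsum
  (ball_summable_conv (qexpansion_summable e1) (qexpansion_summable e2)).
by move/eq_qexpansion; apply => q _; rewrite /phi (rprodE _ e1 e2).
Qed.

(** Multiplication by 1 - t conj b clears the reciprocal in [phi], as regular products are pointwise
    at real points. *)
Lemma phi_real (t : R) : `|t| < 1 ->
  (1 - t%:A * quat_conj b) * phi b t%:A = b - t%:A.
Proof.
move=> t1; have tb : qball (t%:A : H) by exact/qball_real.
have e1 := rrecip_1_sub_conj; have e2 := qexpansion_sub.
rewrite /phi (rprodE _ e1 e2) qsum_conv_real//; last 2 first.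
  exact: geometric_summable.
  exact: qexpansion_summable e2.
by rewrite mulrA geometric_real// mul1r (qsum_qexpansion e2).
Qed.

Lemma phi_coef0 : phi_coef 0%N = b.
Proof. by rewrite /phi_coef qconv0 expr0 mul1r. Qed.

Lemma phi_coef1 : phi_coef 1%N = (`|b| ^+ 2 - 1)%:A.
Proof.
rewrite /phi_coef qconv1 expr0 expr1 mul1r /=.
by rewrite qmul_conjl scalerBl scale1r addrC.
Qed.

Variable u : H.

(** Convolution with 0, 1 is the shift by one index. The extremal function is the Cayley transform
    of the function with these coefficients. *)
Definition blaschke_coef : nat -> H :=
  fun n => qconv (fun n => [:: 0; 1]`_n) phi_coef n * u.

Lemma blaschke_expansion : qexpansion (fun q => q * phi b q * u) blaschke_coef.
Proof. exact/qexpansionM_r/qexpansion_mulX/phi_expansion. Qed.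

Lemma blaschke_coef0 : blaschke_coef 0%N = 0.
Proof. by rewrite /blaschke_coef qconv0 /= !mul0r. Qed.

Lemma blaschke_coef1 : blaschke_coef 1%N = b * u.
Proof.
by rewrite /blaschke_coef qconv1 /= mul0r mul1r add0r phi_coef0.
Qed.

Lemma blaschke_coef2 : blaschke_coef 2%N = (`|b| ^+ 2 - 1) *: u.
Proof.
rewrite /blaschke_coef qconv2 /= mul0r mul1r add0r.
by rewrite mul0r addr0 phi_coef1 mulr_algl.
Qed.

Lemma blaschke_add1_expansion :
  qexpansion (fun q => q * phi b q * u + 1) (fun n => blaschke_coef n + [:: 1]`_n).
Proof. exact: qexpansionD blaschke_expansion (@qexpansion_cst R 1). Qed.

Lemma blaschke_1sub_expansion :
  qexpansion (fun q => 1 - q * phi b q * u) (fun n => [:: 1]`_n + blaschke_coef n * -1).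
Proof.
have := qexpansionD (@qexpansion_cst R 1) (qexpansionM_r (u := -1) blaschke_expansion).
by move/eq_qexpansion; apply => q _; rewrite mulrN1.
Qed.

Hypothesis u1 : `|u| = 1.

Lemma blaschke_real (t : R) : `|t| < 1 ->
  (1 - t *: quat_conj b) * (t%:A * phi b t%:A * u) = t *: ((b - t%:A) * u).
Proof.
move=> t1; rewrite -(qA_comm t) !mulrA.
have := phi_real t1; rewrite mulr_algl => ->.
by rewrite -mulrA mulr_algl scalerAr.
Qed.

(** If the value were 1, [blaschke_real] would give |1 - t conj b| = t |b - t|; but the left side is
    at least 1 - t > 3/4 and the right side at most 2t < 1/2. *)
Lemma blaschke_neq1 (t : R) : 0 < t -> t < 4^-1 -> t%:A * phi b t%:A * u != 1.
Proof.
move=> t0 t4; have t1 : `|t| < 1 by rewrite ger0_norm; lra.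
apply/eqP => W1; have := blaschke_real t1; rewrite W1 mulr1 => E.
have : `|1 - t *: quat_conj b| = t * `|b - t%:A|.
  by rewrite E normrZ qnormM u1 mulr1 gtr0_norm.
have h1 : 1 - t <= `|1 - t *: quat_conj b|.
  have := ler_normD (1 - t *: quat_conj b) (t *: quat_conj b).
  rewrite subrK qnorm1 normrZ qnorm_conj gtr0_norm//.
  by have := ler_piMr (ltW t0) b1; lra.
have h2 : `|b - t%:A| <= 2.
  apply: (le_trans (ler_normB _ _)); rewrite qnormA gtr0_norm//.
  by apply: (le_trans (lerD b1 (ltW t4))); lra.
have := ler_wpM2l (ltW t0) h2; lra.
Qed.

End Phi.

(** * The extremal functions *)

Section Extremal.
Context {R : realType}.
Local Notation H := (quat R).

(* In the extremal case, a null vector of the form of [accretive_kernel]. *)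
Definition toeplitz_vec (a1 u : H) : nat -> H :=
  fun n => [:: 1; - (2^-1 *: (a1 + quat_conj a1 * u)); u]`_n.

(** The choice of phase turns the last term of [toeplitz3] into -|a_2 - a_1^2 / 2|; the rest
    simplifies by |u| = 1. *)
Lemma toeplitz_form (a : nat -> H) (u : H) : a 0%N = 1 -> `|u| = 1 ->
  a 2%N - 2^-1 *: a 1%N ^+ 2 = - (`|a 2%N - 2^-1 *: a 1%N ^+ 2| *: u) ->
  \sum_(j < 3) qre (quat_conj (toeplitz_vec (a 1%N) u j) *
                    qconv a (toeplitz_vec (a 1%N) u) j) =
  2 - `|a 1%N| ^+ 2 / 2 - `|a 2%N - 2^-1 *: a 1%N ^+ 2|.
Proof.
move=> a0 u1 hD.
set c1 := - (2^-1 *: (a 1%N + quat_conj (a 1%N) * u)).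
have := @toeplitz3 R (a 1%N) (a 2%N) u; rewrite -/c1.
set D := a 2%N - _ in hD *.
have -> : qre (quat_conj u * D) = - `|D|.
  by rewrite hD mulrN -scalerAr qmul_conjl u1 expr1n scale1r qreN qreZ mulr1 -hD.
rewrite u1 expr1n mulr1 => T.
have E0 : qconv a (toeplitz_vec (a 1%N) u) 0 = 1.
  by rewrite qconv0 a0 mul1r.
have E1 : qconv a (toeplitz_vec (a 1%N) u) 1 = a 1%N + c1.
  by rewrite qconv1 a0 mul1r mulr1 addrC.
have E2 : qconv a (toeplitz_vec (a 1%N) u) 2 = a 2%N + a 1%N * c1 + u.
  rewrite qconv2 a0 mul1r mulr1 -[toeplitz_vec _ u 1]/c1 -[toeplitz_vec _ u 2]/u.
  by rewrite addrC (addrC u) addrA.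
have sum3 (F : nat -> R) : \sum_(j < 3) F j = F 0%N + F 1%N + F 2%N.
  by rewrite !big_ord_recr big_ord0 /= add0r.
rewrite (sum3 (fun j => qre (quat_conj (toeplitz_vec _ u j) * qconv a _ j))).
rewrite E0 E1 E2 qconj1 mul1r -[toeplitz_vec _ u 1]/c1 -[toeplitz_vec _ u 2]/u.
cbv zeta in T; rewrite -[qre 1]/(1 : R); lra.
Qed.

Lemma ex_opposite_phase (D : H) : exists2 u : H, `|u| = 1 & D = - (`|D| *: u).
Proof.
have [->|D0] := eqVneq D 0.
  by exists 1; rewrite ?qnorm1// normr0 scale0r oppr0.
exists (- (`|D|^-1 *: D)).
  by rewrite normrN normrZ normfV normr_id mulVf// normr_eq0.
by rewrite scalerN opprK scalerA divff ?normr_eq0// scale1r.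
Qed.

(* With [W] the function [q * phi_b(q) * u] at [q = t] and [p] the factor to the
   right of [F], one has [p = (1 - W) (1 - t v^* u)]. *)
Lemma cayley_inverse (b u F : H) (t : R) : `|b| <= 1 -> `|u| = 1 ->
  0 < t -> t < 4^-1 ->
  let v := b * u in let v' := quat_conj v * u in
  F * (1 - t *: (v + v') + t ^+ 2 *: u) = 1 + t *: (v - v') - t ^+ 2 *: u ->
  (1 - t%:A * phi b t%:A * u) * (F + 1) = 2%:R%:A.
Proof.
move=> b1 u1 t0 t4 v v'; set W := t%:A * _ * u; set p := 1 - _ + _ => Fp.
have t1 : `|t| < 1 by rewrite gtr0_norm//; lra.
(* Thus u intertwines 1 - t v' with 1 - t conj b. *)
have vE : quat_conj b * u = u * v'.
  by rewrite /v' /v qconjM !mulrA qmul_conjr u1 expr1n scale1r mul1r.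
have unit_small (x : H) : `|x| <= 1 -> 1 - t *: x \is a GRing.unit.
  move=> x1; rewrite qunitE subr_eq0; apply/eqP => /(congr1 Num.norm).
  rewrite qnorm1 normrZ gtr0_norm// => h.
  by have := ler_wpM2l (ltW t0) x1; lra.
(* Cancel 1 - t conj b on the left: it passes through u by [vE], and through b - t because b
   commutes with its conjugate. *)
have WE : W * (1 - t *: v') = t *: v - t ^+ 2 *: u.
  apply: (@mulrI _ (1 - t *: quat_conj b)).
    by apply: unit_small; rewrite qnorm_conj.
  rewrite mulrA /W (blaschke_real b1)// -scalerAl -mulrA.
  have -> : u * (1 - t *: v') = (1 - t *: quat_conj b) * u.
    by rewrite mulrBr mulr1 -scalerAr -vE mulrBl mul1r -scalerAl.
  rewrite mulrA.
  have -> : (b - t%:A) * (1 - t *: quat_conj b) = (1 - t *: quat_conj b) * (b - t%:A).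
    rewrite !mulrBl !mulrBr !mulr1 !mul1r -!scalerAl -!scalerAr qmul_conjr.
    rewrite qmul_conjl mul1r mulr1.
    by apply: quatP => /=; ring.
  rewrite -mulrA scalerAr; congr (_ * _).
  by rewrite mulrBl mulr_algl scalerBr scalerA expr2.
have pE : (1 - W) * (1 - t *: v') = p.
  by rewrite mulrBl mul1r WE /p; apply: quatP => /=; ring.
have p0 : p \is a GRing.unit.
  rewrite -pE unitrMr.
    by apply: unit_small; rewrite qnormM qnorm_conj /v qnormM u1 !mulr1.
  by rewrite qunitE subr_eq0 eq_sym blaschke_neq1.
(* Multiply by [p] on the right: (F + 1) p = 2 (1 - t v'), and (1 - W) (1 - t v') = p. *)
apply: (mulIr p0); rewrite -mulrA [(F + 1) * p]mulrDl Fp mul1r.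
have -> : 1 + t *: (v - v') - t ^+ 2 *: u + p = 2%:R *: (1 - t *: v').
  by rewrite /p; apply: quatP => /=; ring.
by rewrite -scalerAr pE mulr_algl.
Qed.

Lemma qexpansion_quadratic (x y z : H) :
  qexpansion (fun q => x + q * y + q ^+ 2 * z) (fun n => [:: x; y; z]`_n).
Proof.
refine (eq_qexpansion (@qexpansion_seq R [:: x; y; z]) _) => q _.
by rewrite !big_nat_recr//= big_geq// add0r expr0 mul1r expr1.
Qed.

(** With v = b u = a_1 / 2 the middle entry is -(v + conj(v) u). Rows 1 and 2 follow from the values
    of a_1 and a_2, and the later rows vanish by the kernel hypothesis, so regular multiplication by
    [a] takes one quadratic polynomial to another. *)
Lemma toeplitz_kernel_conv (a : nat -> H) (b u : H) : a 0%N = 1 -> `|u| = 1 ->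
  `|b| <= 1 -> a 1%N = 2 *: (b * u) ->
  a 2%N - 2^-1 *: a 1%N ^+ 2 = - ((2 - 2 * `|b| ^+ 2) *: u) ->
  (forall j, (3 <= j)%N -> qconv a (toeplitz_vec (a 1%N) u) j = 0) ->
  qconv a (toeplitz_vec (a 1%N) u) =
  fun n => [:: 1; b * u - quat_conj (b * u) * u; - u]`_n.
Proof.
move=> a0 u1 b1 a1 hD hker; set v := b * u in a1 *.
have nv : `|v| = `|b| by rewrite qnormM u1 mulr1.
have c1E : - (2^-1 *: (a 1%N + quat_conj (a 1%N) * u)) = - (v + quat_conj v * u).
  by rewrite a1 qconjZ -scalerAl -scalerDr scalerA mulVf ?scale1r.
apply/funext => -[|[|[|j]]].
- by rewrite qconv0 a0 mul1r.
- rewrite qconv1 a0 mul1r mulr1 [toeplitz_vec _ _ _]c1E a1.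
  by move: (quat_conj v * u) => w; apply: quatP => /=; ring.
- rewrite qconv2 a0 mul1r mulr1 [toeplitz_vec _ _ 1]c1E -[toeplitz_vec _ _ 2]/u.
  have -> : a 2%N = 2 *: v ^+ 2 - (2 - 2 * `|b| ^+ 2) *: u.
    rewrite -hD a1 exprZn addrC scalerA (_ : 2^-1 * 2 ^+ 2 = 2) ?subrK//.
    by field.
  have -> : a 1%N * - (v + quat_conj v * u) = - (2 *: v ^+ 2 + (2 * `|b| ^+ 2) *: u).
    rewrite a1 mulrN -scalerAl mulrDr (mulrA v (quat_conj v)) qmul_conjr nv.
    by rewrite mulr_algl scalerDr scalerA expr2.
  by move: (v ^+ 2) => w; apply: quatP => /=; ring.
- by rewrite hker//= nth_nil.
Qed.

(** Let W be q phi_b(q) u. By [cayley_inverse], (1 - W) (f + 1) = 2 at small positive reals, so (f +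
    1) / 2, with coefficients [h], is the regular reciprocal of 1 - W. Its regular product with W +
    1 is f, by uniqueness of coefficients. *)
Lemma extremal_form (f : H -> H) (a : nat -> H) (b u : H) :
  qexpansion f a -> `|b| <= 1 -> `|u| = 1 ->
  qconv a (toeplitz_vec (2 *: (b * u)) u) =
    (fun n => [:: 1; b * u - quat_conj (b * u) * u; - u]`_n) ->
  forall q, qball q -> f q = rprod (fun z => z * phi b z * u + 1)
    (rrecip (fun z => 1 - z * phi b z * u)) q.
Proof.
move=> fa b1 u1 hconv; have sa := qexpansion_summable fa.
set v := b * u in hconv.
have cayley : \forall t \near 0^'+,
    (1 - t%:A * phi b t%:A * u) * (f t%:A + 1) = 2%:R%:A.
  near=> t; have t1 : `|t| < 1 by near: t; exact: near0_lt1.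
  have tb : qball (t%:A : H) by exact/qball_real.
  have t0 : 0 < t by near: t; exact: nbhs_right_gt.
  have t4 : t < 4^-1 by near: t; apply: nbhs_right_lt; lra.
  apply: cayley_inverse => //.
  have ec := @qexpansion_quadratic 1 (- (v + quat_conj v * u)) u.
  have ed := @qexpansion_quadratic 1 (v - quat_conj v * u) (- u).
  have := qsum_conv_real sa (qexpansion_summable ec) t1.
  rewrite (qsum_qexpansion ec)// (qsum_qexpansion fa)// !qA_exp !mulr_algl.
  rewrite -/v scalerN => <-.
  have -> : (fun n => [:: 1; - (v + quat_conj v * u); u]`_n) =
      toeplitz_vec (2 *: v) u.
    by rewrite /toeplitz_vec qconjZ -scalerAl -scalerDr scalerA mulVf ?scale1r//.
  by rewrite hconv (qsum_qexpansion ed)// qA_exp !mulr_algl scalerN.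
have e1 := @blaschke_add1_expansion R b b1 u.
have e2 := @blaschke_1sub_expansion R b b1 u.
have eh := qexpansionM_r (u := (2^-1)%:A) (qexpansionD fa (qexpansion_cst (x := 1))).
have sh := qexpansion_summable eh.
set h := (fun n : nat => _ * _) in eh sh.
have er : qexpansion (rrecip (fun z => 1 - z * phi b z * u)) h.
  apply: (rrecip_expansion e2 sh).
  near=> t; have t1 : `|t| < 1 by near: t; exact: near0_lt1.
  have tb : qball (t%:A : H) by exact/qball_real.
  rewrite (qsum_qexpansion eh)// mulrA.
  rewrite (_ : (1 - t%:A * phi b t%:A * u) * (f t%:A + 1) = 2%:R%:A).
    by rewrite -scalerAl mul1r scalerA divff ?scale1r.
  by near: t.
have aE : qconv (fun n => blaschke_coef b u n + [:: 1]`_n) h = a.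
  apply: qsum_near0_inj => //.
    exact: ball_summable_conv (qexpansion_summable e1) sh.
  near=> t; have t1 : `|t| < 1 by near: t; exact: near0_lt1.
  have tb : qball (t%:A : H) by exact/qball_real.
  rewrite (qsum_conv_real (qexpansion_summable e1) sh t1).
  rewrite (qsum_qexpansion e1)// (qsum_qexpansion eh)// (qsum_qexpansion fa)//.
  have : (1 - t%:A * phi b t%:A * u) * (f t%:A + 1) = 2%:R%:A by near: t.
  (* Here (W + 1) (F + 1) = 2 (F + 1) - (1 - W) (F + 1) = 2 F. *)
  move: (t%:A * phi b t%:A * u) (f t%:A) => W F WF.
  rewrite mulrA (_ : (W + 1) * (F + 1) = 2%:R *: F).
    by rewrite -scalerAl -scalerAr mulr1 scalerA divff ?scale1r.
  have -> : W + 1 = 2%:R%:A - (1 - W) by apply: quatP => /=; ring.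
  by rewrite mulrBl WF mulr_algl; apply: quatP => /=; ring.
by move=> q qb; rewrite (rprodE _ e1 er) aE (qsum_qexpansion fa).
Unshelve. all: by end_near. Qed.

(** Let w_n be the coefficients of W = q phi_b(q) u. Clearing the reciprocal gives 1 + W as the
    regular product of f and 1 - W; as w_0 = 0, degrees 1 and 2 give a_1 = 2 w_1 and a_2 = 2 w_2 + 2
    w_1^2. *)
Lemma extremal_coef (f : H -> H) (a : nat -> H) (b u : H) :
  qexpansion f a -> a 0%N = 1 -> `|b| <= 1 -> `|u| = 1 ->
  (forall q, qball q -> f q = rprod (fun z => z * phi b z * u + 1)
    (rrecip (fun z => 1 - z * phi b z * u)) q) ->
  a 1%N = 2 *: (b * u) /\
  a 2%N - 2^-1 *: a 1%N ^+ 2 = - ((2 - 2 * `|b| ^+ 2) *: u).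
Proof.
move=> fa a0 b1 u1 fE; have sa := qexpansion_summable fa.
have e1 := @blaschke_add1_expansion R b b1 u.
have e2 := @blaschke_1sub_expansion R b b1 u.
(* Without an expansion [qcoef] would be the default zero sequence, the regular product would vanish
   at 0, and f(0) = a_0 = 1 would fail. *)
have [h er] : exists h, qexpansion (rrecip (fun z => 1 - z * phi b z * u)) h.
  apply: contrapT => noexp.
  have c0 : qcoef (rrecip (fun z => 1 - z * phi b z * u)) = (fun=> 0).
    apply: xgetPN => h er; apply: noexp; by exists h.
  have b0 : qball (0 : H) by rewrite /qball/= normr0.
  have f0 : f 0 = 0.
    rewrite fE// /rprod c0; apply: cvg_lim => //.
    rewrite (_ : qseries _ _ = cst 0); first exact: cvg_cst.
    apply/funext => n; rewrite /qseries /series/= big1// => k _.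
    by rewrite big1 ?mulr0// => i _; rewrite mulr0.
  have f1 : f 0 = 1.
    rewrite -(qsum_qexpansion fa b0); apply: cvg_lim => //.
    apply: cvg_near_cst; exists 1%N => // -[|n] //= _.
    rewrite /qseries /series/= big_nat_recl//= expr0 mul1r a0 big1 ?addr0// => i _.
    by rewrite expr0n mul0r.
  by move/eqP: f1; rewrite f0 eq_sym oner_eq0.
have sh := qexpansion_summable er.
have aE : qconv a (fun n => [:: 1]`_n + blaschke_coef b u n * -1) =
    (fun n => blaschke_coef b u n + [:: 1]`_n).
  apply: qsum_near0_inj.
  - exact: ball_summable_conv sa (qexpansion_summable e2).
  - exact: qexpansion_summable e1.
  near=> t; have t1 : `|t| < 1 by near: t; exact: near0_lt1.
  have t0 : 0 < t by near: t; exact: nbhs_right_gt.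
  have t4 : t < 4^-1 by near: t; apply: nbhs_right_lt; lra.
  have tb : qball (t%:A : H) by exact/qball_real.
  rewrite (qsum_conv_real sa (qexpansion_summable e2) t1).
  rewrite (qsum_qexpansion e1)// (qsum_qexpansion e2)// (qsum_qexpansion fa)//.
  rewrite fE// (rprodE _ e1 er) (qsum_conv_real (qexpansion_summable e1) sh t1).
  rewrite (qsum_qexpansion e1)// (qsum_qexpansion er)// (rrecip_real e2)//.
  by rewrite mulrVK// qunitE subr_eq0 eq_sym blaschke_neq1.
have w0 := @blaschke_coef0 R b u; have w1 := @blaschke_coef1 R b u.
have w2 := @blaschke_coef2 R b u.
have a1 : a 1%N = 2 *: (b * u).
  have := congr1 (fun s => s 1%N) aE; rewrite qconv1 /=.
  rewrite a0 w0 w1 !mul0r !addr0 mul1r mulr1 add0r mulrN1 => /eqP.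
  rewrite addrC subr_eq => /eqP ->.
  by apply: quatP => /=; ring.
split=> //.
have := congr1 (fun s => s 2%N) aE; rewrite qconv2 /=.
rewrite a0 w0 w1 w2 a1 !mul0r !addr0 mul1r mulr1 !add0r !mulrN1 mulrN -scalerAl -expr2.
rewrite exprZn scalerA => E.
have -> : a 2%N = (`|b| ^+ 2 - 1) *: u + (`|b| ^+ 2 - 1) *: u + 2 *: (b * u) ^+ 2.
  rewrite -[X in X + _ + _]E; move: (a 2%N) ((b * u) ^+ 2) => x y.
  by apply: quatP => /=; ring.
by move: ((b * u) ^+ 2) => y; apply: quatP => /=; field.
Unshelve. all: by end_near. Qed.

End Extremal.

Theorem theorem4p1 (R : realType) (f : quat R -> quat R) (a : nat -> quat R)
    (f_carath : caratheodory f) (a0 : a 0%N = 1) (f_series : qexpansion f a) :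
  `|a 2%N - 2^-1 *: a 1%N ^+ 2| <= 2 - `|a 1%N| ^+ 2 / 2 /\
  (`|a 2%N - 2^-1 *: a 1%N ^+ 2| = 2 - `|a 1%N| ^+ 2 / 2 <->
   exists b u : quat R, [/\ `|b| <= 1, `|u| = 1 &
     forall q, qball q ->
       f q = rprod (fun z => z * phi b z * u + 1)
                   (rrecip (fun z => 1 - z * phi b z * u)) q]).
Proof.
have [_ _ f_pos] := f_carath.
have acc := accretive_of_qre_ge0 f_series (fun q qb => ltW (f_pos q qb)).
have [u u1 hD] := ex_opposite_phase (a 2%N - 2^-1 *: a 1%N ^+ 2).
have form := toeplitz_form a0 u1 hD.
have le : `|a 2%N - 2^-1 *: a 1%N ^+ 2| <= 2 - `|a 1%N| ^+ 2 / 2.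
  by have := acc 3%N (toeplitz_vec (a 1%N) u); rewrite form subr_ge0.
split=> //; split=> [eqD|[b [w [b1 w1 fE]]]]; last first.
  have [a1 a2] := extremal_coef f_series a0 b1 w1 fE.
  (* With |a_1| = 2 |b|, both sides equal 2 - 2 |b|^2. *)
  rewrite a2 normrN normrZ w1 mulr1 a1 normrZ qnormM w1 mulr1 ger0_norm.
    by rewrite ger0_norm//; field.
  by have := exprn_ile1 2 (normr_ge0 b) b1; lra.
(* This witness is forced by a_1 = 2 b u. *)
pose b := 2^-1 *: a 1%N * quat_conj u.
have buE : a 1%N = 2 *: (b * u).
  by rewrite /b -mulrA qmul_conjl u1 expr1n scale1r mulr1 scalerA divff ?scale1r.
have nb : `|b| = `|a 1%N| / 2.
  by rewrite /b qnormM qnorm_conj u1 mulr1 normrZ ger0_norm 1?mulrC//; lra.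
(* Equality makes 2 - 2 |b|^2 the norm of a_2 - a_1^2 / 2, hence nonnegative. *)
have b1 : `|b| <= 1.
  rewrite -(@expr_le1 _ 2)// nb.
  have := normr_ge0 (a 2%N - 2^-1 *: a 1%N ^+ 2); rewrite eqD; lra.
exists b, u; split => //; apply: (extremal_form f_series b1 u1).
rewrite -buE; apply: toeplitz_kernel_conv => //.
  by rewrite hD eqD; congr (- (_ *: _)); rewrite nb; field.
(* Equality makes the value in [form] zero, so [toeplitz_vec] is a null vector. *)
apply: (accretive_kernel a0 acc) => [n n3|]; first by rewrite /toeplitz_vec nth_default.
by rewrite form eqD subrr.
Qed.
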